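(* Let $N\ge1$, $s\in(0,1)$, $p>1$ and $D=D_0\setminus \overline{D}_1$ with $D_0, D_1\subset \mathbb{R}^N$ open bounded sets such that $0\in D_1$ and $\overline{D}_1\subset D_0$. Let $q:D\to [0,\infty)$ be such that (A1) $q$ is a bounded Borel function, and (A2) for all $t\geq 1$ and $x\in D$ such that $tx\in D$ we have $t^{sp}q(tx)\geq q(x)$. Let $u:\mathbb{R}^N\to\mathbb{R}$ be a continuous bounded weak solution of $$(-\Delta)^s_pu+q(x)|u|^{p-2}u=0 \ \text{ in } D,\qquad u=0\ \text{ on } \mathbb{R}^N\setminus D_0,\qquad u=1\ \text{ on } D_1,$$ such that $0\leq u\leq 1$. Assume that $D_0$ and $D_1$ are starshaped. Then the superlevel sets $U(\ell)=\{x\in\mathbb{R}^N: u(x)\ge \ell\}$ of $u$ are starshaped for all $\ell\in (0,1)$. If in addition $D_0$ and $D_1$ are strictly starshaped and one of the following holds: (1) $\frac{1}{1-s}<p\leq 2$, or (2) $p\geq 2$ and $u\in C^{\alpha}_{loc}(D)$ for some $\alpha\in(0,1]$ with $\alpha(p-2)>sp-1$, then the superlevel sets $U(\ell)$ of $u$ are strictly starshaped for all $\ell\in (0,1)$.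
   Context: $W^{s,p}(\mathbb{R}^N)$ is the set of $u\in L^p(\mathbb{R}^N)$ with $\int_{\mathbb{R}^N}\int_{\mathbb{R}^N}\frac{|u(x)-u(y)|^p}{|x-y|^{N+sp}}\,dx\,dy<\infty$. For an open set $D\subset\mathbb{R}^N$, $\mathcal{W}^{s,p}_0(D):=\{u\in W^{s,p}(\mathbb{R}^N): u= 0 \text{ a.e. on } \mathbb{R}^N\setminus D\}$ and $\tilde W^{s,p}(D):=\{u\in L^p_{loc}(\mathbb{R}^N): \int_D\int_{\mathbb{R}^N}\frac{|u(x)-u(y)|^p}{|x-y|^{N+sp}}\,dx\,dy<\infty\}$. A weak solution of the boundary value problem is a function $u\in\tilde W^{s,p}(D)$ with $u=0$ on $\mathbb{R}^N\setminus D_0$, $u=1$ on $D_1$, and such that for all nonnegative $\varphi\in\mathcal{W}^{s,p}_0(D)$ with compact support in $\mathbb{R}^N$, $$\int_{\mathbb{R}^N}\int_{\mathbb{R}^N}\frac{|u(x)-u(y)|^{p-2}(u(x)-u(y))(\varphi(x)-\varphi(y))}{|x-y|^{N+sp}}\,dx\,dy+\int_D q|u|^{p-2}u\,\varphi\,dx=0 .$$ (Here $|a|^{p-2}a:=0$ for $a=0$.) A set $A\subset\mathbb{R}^N$ is starshaped (with respect to $0\in A$) if $\tau A\subseteq A$ for every $\tau\in[0,1]$. $A$ is strictly starshaped if $0$ is in the interior of $A$ and any ray starting from $0$ intersects the boundary of $A$ in only one point. $C^\alpha_{loc}(D)$ denotes the functions that are Hölder continuous with exponent $\alpha$ (Lipschitz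 if $\alpha=1$) on every compact subset of $D$. *)

(* Defs.v *)
From HB Require Import structures.
From mathcomp Require Import all_boot all_order all_algebra.
From mathcomp Require Import all_classical all_reals all_analysis.
From mathcomp Require Import measurable_realfun.

Set Implicit Arguments.
Unset Strict Implicit.
Unset Printing Implicit Defensive.
Import Order.TTheory GRing.Theory Num.Theory.
Import numFieldNormedType.Exports.

Local Open Scope classical_set_scope.
Local Open Scope ring_scope.

(* R^n is 'rV[R]_n. Its library topology comes from the sup norm, so open,
   bounded and compact sets are the Euclidean ones; its measurable sets are
   declared here to be the Borel sets of that topology. *)
HB.instance Definition _ (R : realType) (n : nat) :=
  @isMeasurable.Build (sigma_display (@open 'rV[R]_n)) 'rV[R]_n
    <<s @open 'rV[R]_n >>
    (@sigma_algebra0 _ setT _) (@sigma_algebraC _ _)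
    (@sigma_algebra_bigcup _ setT _).

Section borel_rV.
Context {R : realType}.

Lemma open_measurable_rV n (A : set 'rV[R]_n) : open A -> measurable A.
Proof. exact: sub_sigma_algebra. Qed.

Let cube n (k : 'rV[rat]_n * rat) : set 'rV[R]_n :=
  [set y | forall i, `|ratr (k.1 0 i) - y 0 i| < ratr k.2].

Let open_bigcup_cube n (A : set 'rV[R]_n) : open A ->
  A = \bigcup_(k in [set k | cube k `<=` A]) cube k.
Proof.
move=> oA; apply/seteqP; split => [x Ax|x [k kA]]; last exact: kA.
have /nbhs_ballP[e /= e0 eA] : nbhs x A by exact: open_nbhs_nbhs.
have [r] := @rat_in_itvoo R 0 (e / 2) (divr_gt0 e0 (ltr0n _ 2)).
rewrite in_itv/= => /andP[r0 re].
have H i : exists q : rat, ratr q \in `](x 0 i - ratr r), (x 0 i + ratr r)[.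
  by apply: rat_in_itvoo; rewrite ltrBlDr -addrA ltrDl addr_gt0.
pose c : 'rV[rat]_n := \row_i projT1 (cid (H i)).
have cP i : `|ratr (c 0 i) - x 0 i| < ratr r.
  by rewrite mxE; case: cid => q /=; rewrite in_itv/= ltr_distl.
exists (c, r) => //= y yc; apply: eA; split => // i j; rewrite ord1.
rewrite /ball/= (le_lt_trans (ler_distD (ratr (c 0 j)) _ _))//.
rewrite (splitr e) ltrD//; last exact: lt_trans (yc j) re.
by rewrite distrC; exact: lt_trans (cP j) re.
Qed.

Lemma measurable_fun_rV d (T : measurableType d) n (D : set T)
    (f : T -> 'rV[R]_n) :
  (forall i, measurable_fun D (fun t => f t 0 i)) -> measurable_fun D f.
Proof.
move=> mf; have [mD|nD] := pselect (measurable D); last by move=> /nD.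
apply: (@measurability _ _ _ _ _ _ (@open 'rV[R]_n)) => //.
move=> _ [A oA <-]; rewrite (open_bigcup_cube oA) preimage_bigcup setI_bigcupr.
rewrite bigcup_mkcond; apply: countable_bigcupT_measurable => // k.
case: ifP => // _.
rewrite (_ : _ `&` _ = D `&` \bigcap_i (D `&` (fun t => f t 0 i) @^-1`
  [set y | `|ratr (k.1 0 i) - y| < ratr k.2])); last first.
  apply/seteqP; split => [t [Dt tk]|t [Dt tk]].
    by split => // i _; split => //; exact: tk.
  by split => // i; have [] := tk i Logic.I.
apply: measurableI => //; apply: fin_bigcap_measurable => // i _.
apply: mf => //; apply: open_measurable.
by rewrite (_ : mkset _ = ball (ratr (k.1 0 i) : R) (ratr k.2)) //; exact: ball_open.
Qed.

Lemma measurable_coord_rV n (i : 'I_n) :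
  measurable_fun [set: 'rV[R]_n] (fun x : 'rV[R]_n => x 0 i).
Proof.
apply: (measurability _ (RGenOInfty.measurableE R)).
move=> _ [_ [a ->] <-]; rewrite setTI; apply: open_measurable_rV.
by apply: open_comp => [x _|]; [exact: coord_continuous|exact: interval_open].
Qed.

Definition rV_cons n (z : 'rV[R]_n * measurableTypeR R) : 'rV[R]_n.+1 :=
  \row_i oapp (z.1 0) z.2 (unlift ord0 i).

Lemma measurable_rV_cons n : measurable_fun setT (@rV_cons n).
Proof.
apply: measurable_fun_rV => i; under eq_fun do rewrite mxE.
case: unliftP => [j _|_] /=; last exact: measurable_snd.
apply: (@measurableT_comp _ _ _ _ _ _ (fun x : 'rV[R]_n => x 0 j)).
  exact: measurable_coord_rV.
exact: measurable_fst.
Qed.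

Section step.
Variables (n : nat) (mu : {measure set 'rV[R]_n -> \bar R}).

Definition lebesgue_step : set 'rV[R]_n.+1 -> \bar R :=
  pushforward (mu \x (@lebesgue_measure R))%E (@rV_cons n).

HB.instance Definition _ := Measure.copy lebesgue_step
  (measure_function_pushforward__canonical__measure_function_Measure
     (mu \x (@lebesgue_measure R))%E (@measurable_rV_cons n)).

End step.

(* Lebesgue measure on the Borel sets of R^n, as an iterated product of the
   one-dimensional one; see lebesgue_rV_box for the volume of boxes. *)
Fixpoint lebesgue_rec n : {measure set 'rV[R]_n -> \bar R} :=
  if n is n'.+1 then lebesgue_step (lebesgue_rec n') else dirac (0 : 'rV[R]_0).

Definition lebesgue_rV n : set 'rV[R]_n -> \bar R := lebesgue_rec n.

HB.instance Definition _ n := Measure.on (@lebesgue_rV n).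

Definition box n (a b : 'rV[R]_n) : set 'rV[R]_n :=
  [set x | forall i, a 0 i < x 0 i <= b 0 i].

Lemma measurable_box n (a b : 'rV[R]_n) : measurable (box a b).
Proof.
rewrite (_ : box a b = \bigcap_(i in setT) (setT `&`
   (fun x : 'rV[R]_n => x 0 i) @^-1` `]a 0 i, b 0 i]%classic)).
  apply: fin_bigcap_measurable => // i _.
  by apply: measurable_coord_rV => //; exact: measurable_itv.
apply/seteqP; split => [x xab i _|x xab i].
  by split => //=; rewrite in_itv/=; exact: xab.
by have [_] := xab i Logic.I; rewrite /= in_itv.
Qed.

Lemma lebesgue_rV_box n (a b : 'rV[R]_n) : (forall i, a 0 i <= b 0 i) ->
  lebesgue_rV (box a b) = (\prod_i (b 0 i - a 0 i))%:E.
Proof.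
elim: n a b => [|n ih] a b ab.
  rewrite big_ord0 /lebesgue_rV/= diracE mem_set// => -[]//.
rewrite big_ord_recl.
pose tl (c : 'rV[R]_n.+1) : 'rV[R]_n := \row_i c 0 (lift ord0 i).
pose I : set R := `]a 0 ord0, b 0 ord0]%classic.
transitivity (lebesgue_rV (box (tl a) (tl b)) * lebesgue_measure I)%E.
  transitivity ((lebesgue_rec n \x @lebesgue_measure R)%E
      (box (tl a) (tl b) `*` I)); last first.
    apply: product_measure1E; first exact: measurable_box.
    exact: measurable_itv.
  rewrite {1}/lebesgue_rV/= /lebesgue_step /pushforward; congr (_ _).
  apply/seteqP; split => -[x t] /=.
    move=> xt; split => [i|].
      by have := xt (lift ord0 i); rewrite !mxE liftK.
    by have := xt ord0; rewrite !mxE unlift_none /I /= in_itv.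
  move=> [xt]; rewrite /I /= in_itv/= => tab i; rewrite mxE.
  case: unliftP => [j ->|->] //=.
  by have := xt j; rewrite !mxE.
rewrite ih; last by move=> i; rewrite !mxE.
rewrite lebesgue_measure_itv/= lte_fin.
under eq_bigr do rewrite !mxE.
rewrite mulrC; case: ltP => [_|ba]; first by rewrite -EFinD -EFinM.
by rewrite (@le_anti _ _ (a 0 ord0) (b 0 ord0)) ?ab ?ba// subrr mulr0 mule0.
Qed.

Let lebesgue_rV_sigma_finite n : sigma_finite setT (@lebesgue_rV n).
Proof.
exists (fun k : nat => box (const_mx (- k%:R)) (const_mx k%:R)).
  apply/esym; rewrite -subTset => x _.
  exists (Num.truncn `|x|).+1 => // i; rewrite !mxE.
  have xi : `|x 0 i| <= `|x|.
    by rewrite [leRHS]mx_normrE (le_bigmax _ (fun ij => `|x ij.1 ij.2|) (ord0, i)).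
  have h : `|x 0 i| < (Num.truncn `|x|).+1%:R by rewrite (le_lt_trans xi)// truncnS_gt.
  by move: h; rewrite ltr_norml => /andP[-> /ltW].
move=> k; split; first exact: measurable_box.
by rewrite lebesgue_rV_box ?ltry// => i; rewrite !mxE ge0_cp.
Qed.

HB.instance Definition _ n :=
  Measure_isSigmaFinite.Build _ _ _ (@lebesgue_rV n) (@lebesgue_rV_sigma_finite n).

End borel_rV.

Section fractional_sobolev.
Context {R : realType} {N : nat}.
Implicit Types (s p : R) (D : set 'rV[R]_N) (u phi : 'rV[R]_N -> R).

Local Notation mu := (@lebesgue_rV R N).

(* The norm `|x| of the library is the sup norm. *)
Definition eucl_norm (x : 'rV[R]_N) : R := Num.sqrt (\sum_i x 0 i ^+ 2).

(* On the null diagonal x = y the quotients below have the value 0. *)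
Definition gagliardo s p D u : \bar R :=
  (\int[mu]_(x in D) \int[mu]_y
    (`|u x - u y| `^ p / eucl_norm (x - y) `^ (N%:R + s * p))%:E)%E.

Definition Wsp s p : set ('rV[R]_N -> R) :=
  [set u : 'rV[R]_N -> R | u \in Lfun mu p%:E /\ (gagliardo s p setT u < +oo)%E].

Definition Wsp0 s p D : set ('rV[R]_N -> R) :=
  [set u : 'rV[R]_N -> R | Wsp s p u /\ {ae mu, forall x, ~ D x -> u x = 0}].

Definition Lploc p : set ('rV[R]_N -> R) :=
  [set u : 'rV[R]_N -> R | measurable_fun setT u /\
    forall K : set 'rV[R]_N, compact K ->
      (\int[mu]_(x in K) (`|u x| `^ p)%:E < +oo)%E].

Definition Wtilde s p D : set ('rV[R]_N -> R) :=
  [set u : 'rV[R]_N -> R | Lploc p u /\ (gagliardo s p D u < +oo)%E].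

(* |a|^(p-2) a, with value 0 at a = 0. *)
Definition signed_pow p (a : R) : R := `|a| `^ (p - 2) * a.

Definition frac_plap_form s p u phi : \bar R :=
  (\int[mu]_x \int[mu]_y
    (signed_pow p (u x - u y) * (phi x - phi y) /
       eucl_norm (x - y) `^ (N%:R + s * p))%:E)%E.

(* Weak solution of (-Delta)^s_p u + q |u|^(p-2) u = 0 in D0 \ closure D1,
   u = 0 outside D0, u = 1 on D1; only the values of q on D0 \ closure D1
   matter. *)
Definition weak_solution s p (D0 D1 : set 'rV[R]_N) (q : 'rV[R]_N -> R) u :=
  let D := D0 `\` closure D1 in
  [/\ Wtilde s p D u,
      forall x, ~ D0 x -> u x = 0,
      forall x, D1 x -> u x = 1 &
      forall phi, Wsp0 s p D phi -> (forall x, 0 <= phi x) ->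
        compact (closure [set x | phi x != 0]) ->
        (frac_plap_form s p u phi +
         \int[mu]_(x in D) (q x * signed_pow p (u x) * phi x)%:E = 0)%E].

Definition holder_loc (alpha : R) D u :=
  forall K : set 'rV[R]_N, compact K -> K `<=` D ->
    exists C : R, forall x y, K x -> K y ->
      `|u x - u y| <= C * eucl_norm (x - y) `^ alpha.

End fractional_sobolev.

Section starshaped.
Context {R : realType} {N : nat}.
Implicit Types A : set 'rV[R]_N.

Definition starshaped A :=
  A 0 /\ forall tau : R, 0 <= tau <= 1 -> [set tau *: x | x in A] `<=` A.

Definition boundary A : set 'rV[R]_N := closure A `\` A°.

Definition ray (v : 'rV[R]_N) : set 'rV[R]_N :=
  [set t *: v | t in [set t : R | 0 <= t]].

Definition strictly_starshaped A :=
  A° 0 /\ forall v, v != 0 -> exists! y, (ray v `&` boundary A) y.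

Definition superlevel (u : 'rV[R]_N -> R) (l : R) : set 'rV[R]_N :=
  [set x | l <= u x].

End starshaped.

(* Main.v *)
Require Import Defs.
From mathcomp Require Import all_boot all_order all_algebra.
From mathcomp Require Import all_classical all_reals all_analysis.
From mathcomp Require Import measurable_realfun.
From mathcomp Require Import ring lra.
Set Implicit Arguments.
Unset Strict Implicit.
Unset Printing Implicit Defensive.
Import Order.TTheory GRing.Theory Num.Theory.
Import numFieldNormedType.Exports.
Local Open Scope classical_set_scope.
Local Open Scope ring_scope.

(** Write [J a = |a|^(p-2) a], [k (x, y) = |x - y|^-(N + s p)] and
    [u_t x = u (t x)] for [t >= 1].  The superlevel sets of [u] are starshaped
    as soon as [u_t <= u] for all [t >= 1] ([scaled_le]).

    By homogeneity [u_t] solves the same equation with the potential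
    [t^(s p) q (t x)], which by (A2) is at least [q x].  So on
    [G = {x in D | t x in D}] the function [u_t] is a subsolution of the
    equation of [u], and off [G] the inequality [u_t <= u] holds because [D0]
    and [closure D1] are starshaped ([scaled_le_outside]).  To compare the two,
    take a bump [zeta >= 0], put [U = u_t + zeta] and [w = (U - u)^+], and
    suppose that [w] vanishes off [G].  Then [w] and [w (./t)] are test
    functions; the equation of [u] tested against both and subtracted bounds

      the double integral of [(J (u_t x - u_t y) - J (u x - u y)) (w x - w y) k]

    by the integral of [q (J u - J u_t) w] ([form_scaled_diff]).  With [U] in
    place of [u_t] the integrand is nonnegative because [J] is increasing, and
    it is at least [c k0 w x] when [U - u] is larger at [x] than at [y] by a
    fixed amount and [U y <= u y].  Integrating over [B] times [Z] yields
    [comparison_estimate]: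

      [c k0 |Z| (integral of w over B) <=
          (size of the potential term + size of the error) (integral of w)],

    where the error comes from the replacement of [u_t] by [U].

    - With [zeta = 0] the right-hand side is [0].  If [u_t > u] at some point,
      take for [B] a ball around it and for [Z] a ball far away from [D0]:
      a contradiction, hence [scaled_le].

    - For strictness, a boundary point of a superlevel set lies on the level
      set, so the claim is that [u_t < u] where [0 < u < 1] and [t > 1]
      ([scaled_lt]).  Otherwise [u_t = u] at some [y0] in [G].  As [u] goes
      from [1] at the origin to [0] outside [D0], there is a ball [Z] on which
      [u_t < u] by a fixed amount ([scaled_lt_somewhere]).  Take for [zeta] a
      tent at [y0] of small radius and much smaller height [d].  Then
      [q (J u - J u_t)] is small on the support of [w], by continuity at [y0],
      and the error tends to [0] with [d], so that both are absorbed by the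
      left-hand side: a contradiction ([no_touching]).

    The error is controlled if [|J (a + h) - J a|], with [a] and [h] the
    increments of [u_t] and of [zeta], is at most
    [C d^th min (|x - y|^b, 1)] for some [b > s p], since such a bound is
    integrable against [k] ([integral_trunc_kernel]).  For [p <= 2] the map [J]
    is Hoelder continuous of exponent [p - 1], and [b = p - 1 > s p] is the
    condition [1/(1-s) < p].  For [p >= 2] it is locally Lipschitz with constant
    of order [|a|^(p-2)], the Hoelder bound on [u] gives
    [b = alpha (p - 2) + 1], and [b > s p] is the condition on [alpha]. *)

(** * The increasing map a |-> |a|^(p-2) a *)

Section signed_power.
Context {R : realType}.
Implicit Types a b c h p x y : R.

Lemma signed_powE p a : 1 < p -> 0 <= a -> signed_pow p a = a `^ (p - 1).
Proof.
move=> p1 a0; rewrite /signed_pow ger0_norm// mulrC.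
by rewrite (_ : p - 2 = p - 1 - 1) ?mulr_powRB1 ?subr_gt0//; ring.
Qed.

Lemma signed_pow0 p : signed_pow p (0 : R) = 0.
Proof. by rewrite /signed_pow mulr0. Qed.

Lemma signed_powN p a : signed_pow p (- a) = - signed_pow p a.
Proof. by rewrite /signed_pow normrN mulrN. Qed.

Lemma norm_signed_pow p a : 1 < p -> `|signed_pow p a| = `|a| `^ (p - 1).
Proof.
move=> p1; rewrite -signed_powE// /signed_pow normrM !normr_id.
by rewrite [X in X * _]ger0_norm// powR_ge0.
Qed.

Lemma signed_pow_lt p a b : 1 < p -> a < b -> signed_pow p a < signed_pow p b.
Proof.
move=> p1.
have pos x y : 0 <= x -> x < y -> signed_pow p x < signed_pow p y.
  move=> x0 xy; have y0 : 0 <= y by rewrite ltW// (le_lt_trans x0).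
  by rewrite !signed_powE// gt0_ltr_powR ?nnegrE// subr_gt0.
move=> ab; have [a0|a0] := leP 0 a; first exact: pos.
have Ja : signed_pow p a < 0.
  by rewrite -[a]opprK signed_powN oppr_lt0 -(signed_pow0 p) pos// oppr_gt0.
have [b0|b0] := leP 0 b.
  by rewrite (lt_le_trans Ja)// signed_powE// powR_ge0.
rewrite -[a]opprK -[b]opprK !(signed_powN p (- _)) ltrN2.
by rewrite pos ?oppr_ge0 ?ltrN2// ltW.
Qed.

Lemma signed_pow_le p a b : 1 < p -> a <= b -> signed_pow p a <= signed_pow p b.
Proof.
by move=> p1; rewrite le_eqVlt => /predU1P[->//|ab]; rewrite ltW// signed_pow_lt.
Qed.

Lemma powR_subadditive (th x y : R) : 0 < th <= 1 -> 0 <= x -> 0 <= y ->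
  (x + y) `^ th <= x `^ th + y `^ th.
Proof.
move=> /andP[th0 th1] x0 y0.
have [xy0|xy0] := eqVneq (x + y) 0.
  by rewrite xy0 powR0 ?gt_eqF// addr_ge0// powR_ge0.
have {xy0}s0 : 0 < x + y by rewrite lt_def xy0 addr_ge0.
have share z : 0 <= z -> z <= x + y -> z / (x + y) * (x + y) `^ th <= z `^ th.
  move=> z0 zs; have [->|zn0] := eqVneq z 0; first by rewrite mul0r mul0r powR_ge0.
  rewrite -{2}(divfK (lt0r_neq0 s0) z) powRM ?divr_ge0 ?(ltW s0)//.
  have zp : 0 < z by rewrite lt_def zn0.
  by rewrite ler_wpM2r ?powR_ge0// ger1_powR// divr_gt0//= ler_pdivrMr// mul1r.
rewrite (le_trans _ (lerD (share x _ _) (share y _ _)))// ?lerDl ?lerDr//.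
by rewrite -mulrDl -mulrDl divff ?gt_eqF// mul1r.
Qed.

(** Dividing by [x ^ th] turns this into a Bernoulli inequality for the ratio
    [y / x]; rounding [th] up to an integer makes it elementary. *)
Lemma powR_sub_le (th : R) : 1 <= th -> exists2 C : R, 0 < C &
  forall x y, 0 <= y -> y <= x -> x `^ th - y `^ th <= C * x `^ (th - 1) * (x - y).
Proof.
move=> th1; pose n := (Num.truncn th).+1.
have thn : th <= n%:R by rewrite ltW// truncnS_gt.
exists n%:R => [|x y y0 yx]; first by rewrite ltr0n.
have [x0|] := eqVneq x 0.
  have -> : y = x by apply/eqP; rewrite eq_le yx x0 y0.
  by rewrite !subrr mulr0.
move=> xn0; have {xn0}x0 : 0 < x by rewrite lt_def xn0 (le_trans y0).
pose r := y / x.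
have r01 : 0 <= r <= 1 by rewrite divr_ge0 ?(ltW x0)//= ler_pdivrMr// mul1r.
have yE : y = r * x by rewrite divfK ?gt_eqF.
have bern m : 1 - r ^+ m <= m%:R * (1 - r).
  elim: m => [|m ih]; first by rewrite expr0 subrr mul0r.
  have rm : r ^+ m <= 1 by rewrite exprn_ile1//; case/andP: r01.
  rewrite exprS -natr1 mulrDl mul1r.
  have -> : 1 - r * r ^+ m = (1 - r ^+ m) + r ^+ m * (1 - r) by ring.
  by rewrite lerD// ler_piMl// subr_ge0; case/andP: r01.
have key : 1 - r `^ th <= n%:R * (1 - r).
  apply: le_trans (bern n); rewrite lerB//.
  have [->|rn0] := eqVneq r 0; first by rewrite expr0n/= powR_ge0.
  rewrite -powR_mulrn; last by case/andP: r01.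
  by rewrite ger_powR// lt_def rn0/=.
rewrite yE powRM ?(ltW x0)//; last by case/andP: r01.
rewrite -{1}[x `^ th]mul1r -mulrBl.
rewrite (_ : _ * (x - r * x) = n%:R * (1 - r) * (x * x `^ (th - 1))); last by ring.
by rewrite mulr_powRB1 ?(ltW x0)// ?(lt_le_trans ltr01 th1)// ler_wpM2r ?powR_ge0.
Qed.

(** Symmetry in [x], [y] and oddness reduce modulus of continuity bounds to
    [0 <= x] and [|y| <= x], where only powers of nonnegative reals occur. *)
Lemma signed_pow_sub_ind p (K : R -> R -> R) : 1 < p ->
  (forall x y, K x y = K y x) -> (forall x y, K (- x) (- y) = K x y) ->
  (forall x y, 0 <= y -> y <= x -> x `^ (p - 1) - y `^ (p - 1) <= K x y) ->
  (forall x y, 0 <= y -> y <= x -> x `^ (p - 1) + y `^ (p - 1) <= K x (- y)) ->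
  forall x y, `|signed_pow p x - signed_pow p y| <= K x y.
Proof.
move=> p1 Ksym Kopp Kpos Kneg.
suff H x y : 0 <= x -> `|y| <= x -> `|signed_pow p x - signed_pow p y| <= K x y.
  have H' x y : `|y| <= `|x| -> `|signed_pow p x - signed_pow p y| <= K x y.
    have [x0|x0] := leP 0 x => yx; first by apply: H => //; rewrite -(ger0_norm x0).
    rewrite (_ : signed_pow p x - _ = - (signed_pow p (- x) - signed_pow p (- y))).
      rewrite normrN -Kopp; apply: H.
        by rewrite oppr_ge0 ltW.
      by rewrite normrN -(ltr0_norm x0).
    by rewrite !signed_powN; ring.
  move=> x y; have [yx|/ltW xy] := leP `|y| `|x|; first exact: H'.
  by rewrite distrC Ksym; exact: H'.
move=> x0 yx; rewrite ger0_norm; last first.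
  by rewrite subr_ge0 signed_pow_le// (le_trans (ler_norm _)).
have [y0|y0] := leP 0 y.
  by rewrite !signed_powE//; apply: Kpos => //; rewrite -(ger0_norm y0).
rewrite -{1}[y]opprK signed_powN opprK !signed_powE ?oppr_ge0 ?(ltW y0)//.
rewrite -{2}[y]opprK; apply: Kneg; rewrite ?oppr_ge0 ?(ltW y0)//.
by rewrite -(ltr0_norm y0).
Qed.

Lemma signed_pow_hoelder p : 1 < p <= 2 ->
  forall x y, `|signed_pow p x - signed_pow p y| <= 2 * `|x - y| `^ (p - 1).
Proof.
move=> /andP[p1 p2]; have th0 : 0 < p - 1 <= 1 by rewrite subr_gt0 p1/= lerBlDr.
apply: signed_pow_sub_ind => //.
- by move=> x y; rewrite distrC.
- by move=> x y; rewrite opprK addrC distrC.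
- move=> x y y0 yx; rewrite ger0_norm ?subr_ge0// lerBlDr.
  rewrite -{1}(subrK y x); have := @powR_subadditive (p - 1) (x - y) y th0.
  rewrite subr_ge0 => /(_ yx y0)/le_trans; apply; rewrite lerD2r.
  by rewrite ler_peMl ?powR_ge0// ler1n.
- move=> x y y0 yx; have x0 := le_trans y0 yx.
  rewrite opprK ger0_norm ?addr_ge0// [2]/(1 + 1) mulrDl !mul1r.
  case/andP: th0 => th0 _.
  by rewrite lerD// ge0_ler_powR ?(ltW th0) ?nnegrE ?addr_ge0// ?lerDl ?lerDr.
Qed.

Lemma signed_pow_lipschitz p : 2 <= p -> exists2 C : R, 0 < C &
  forall x y, `|signed_pow p x - signed_pow p y| <=
              C * (`|x| + `|y|) `^ (p - 2) * `|x - y|.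
Proof.
move=> p2; have p1 : 1 < p by rewrite (lt_le_trans _ p2)// ltr1n.
have th1 : 1 <= p - 1 by rewrite lerBrDr.
have [C C0 CP] := powR_sub_le th1.
have p20 : 0 <= p - 2 by rewrite subr_ge0.
have pE : p - 1 - 1 = p - 2 by ring.
have mono x y : 0 <= x -> 0 <= y -> x <= y -> x `^ (p - 2) <= y `^ (p - 2).
  by move=> x0 y0 xy; rewrite ge0_ler_powR ?nnegrE.
exists (C + 1); first by rewrite addr_gt0.
apply: signed_pow_sub_ind => //.
- by move=> x y; rewrite distrC (addrC `|x|).
- by move=> x y; rewrite -opprD !normrN.
- move=> x y y0 yx; have x0 := le_trans y0 yx.
  rewrite (le_trans (CP _ _ y0 yx))// (@ger0_norm _ (x - y)) ?subr_ge0//.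
  rewrite ler_wpM2r ?subr_ge0// pE ler_pM ?powR_ge0 ?(ltW C0)// ?lerDl//.
  by rewrite mono ?addr_ge0// !ger0_norm// lerDl.
- move=> x y y0 yx; have x0 := le_trans y0 yx.
  rewrite opprK normrN !ger0_norm ?addr_ge0//.
  have half z : 0 <= z -> z <= x + y -> z `^ (p - 1) <= (x + y) `^ (p - 2) * z.
    move=> z0 zs; rewrite -mulr_powRB1 ?subr_gt0// mulrC pE.
    by rewrite ler_wpM2r// mono ?addr_ge0.
  rewrite (le_trans (lerD (half _ x0 _) (half _ y0 _))) ?lerDl ?lerDr//.
  by rewrite -mulrDr -mulrA ler_peMl ?mulr_ge0 ?powR_ge0 ?addr_ge0// lerDr ltW.
Qed.

Lemma continuous_signed_pow p : 1 < p -> continuous (signed_pow p : R -> R).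
Proof.
move=> p1 x; apply/cvgrPdist_le => e e0.
have [p2|/ltW p2] := leP p 2.
  near=> y; rewrite (le_trans (signed_pow_hoelder _ _ _)) ?p1//.
  have q0 : 0 < p - 1 by rewrite subr_gt0.
  have -> : e = 2 * ((e / 2) `^ (p - 1)^-1) `^ (p - 1).
    by rewrite -powRrM mulVf ?gt_eqF// powRr1 ?divr_ge0 ?(ltW e0)// mulrC divfK.
  rewrite ler_pM2l// ge0_ler_powR ?(ltW q0)// ?nnegrE ?powR_ge0// ltW//.
  near: y; apply: (cvgr_dist_lt (id : R -> R) x (@cvg_id _ _)).
  by rewrite powR_gt0// divr_gt0.
have [C C0 CP] := signed_pow_lipschitz p2.
pose L := C * (`|x| + (`|x| + 1)) `^ (p - 2).
have L0 : 0 < L by rewrite mulr_gt0// powR_gt0// ltr_wpDl// ltr_wpDl.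
near=> y; have xy1 : `|x - y| <= 1.
  by near: y; exact: (cvgr_dist_le (id : R -> R) x (@cvg_id _ _)).
rewrite (le_trans (CP _ _))// (@le_trans _ _ (L * `|x - y|))//.
  rewrite ler_wpM2r// ler_wpM2l ?(ltW C0)//.
  rewrite ge0_ler_powR ?nnegrE ?subr_ge0 ?addr_ge0//.
  rewrite lerD2l -lerBlDl (le_trans _ xy1)// distrC.
  exact: le_trans (ler_norm _) (ler_dist_dist _ _).
rewrite -ler_pdivlMl//; near: y; apply: (cvgr_dist_le (id : R -> R) x (@cvg_id _ _)).
by rewrite mulr_gt0// invr_gt0.
Unshelve. all: by end_near. Qed.

(** Strict monotonicity is uniform on bounded sets, by compactness.  The bound
    [c] does not depend on the base point: this is what produces a gain in the
    comparison of two solutions. *)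
Lemma signed_pow_gap p (h M : R) : 1 < p -> 0 < h -> 0 <= M -> exists2 c : R,
  0 < c & forall b b', `|b| <= M -> b + h <= b' ->
    c <= signed_pow p b' - signed_pow p b.
Proof.
move=> p1 h0 M0.
have MM : - M <= M by rewrite (@le_trans _ _ 0)// oppr_le0.
have cf : {within `[- M, M], continuous
    (fun b : R => signed_pow p (b + h) - signed_pow p b)}.
  apply: continuous_subspaceT => b; apply: cvgB; last exact: continuous_signed_pow.
  apply: (@continuous_comp _ _ _ (fun b => b + h) (signed_pow p)).
    by apply: cvgD; [exact: cvg_id|exact: cvg_cst].
  exact: continuous_signed_pow.
have [c _ cmin] := EVT_min MM cf.
exists (signed_pow p (c + h) - signed_pow p c).
  by rewrite subr_gt0 signed_pow_lt// ltrDl.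
move=> b b' bM bb'; rewrite (le_trans (cmin b _)) ?in_itv/= -?ler_norml//.
by rewrite lerB// signed_pow_le.
Qed.

(** Crude form of the Young inequality: the larger of the two numbers bounds
    both factors. *)
Lemma signed_pow_young p a c : 1 < p ->
  `|signed_pow p a * c| <= `|a| `^ p + `|c| `^ p.
Proof.
move=> p1; have p0 : 0 < p by rewrite (lt_trans ltr01).
rewrite normrM norm_signed_pow//.
have H x y : 0 <= x -> 0 <= y -> x <= y -> x `^ (p - 1) * y <= y `^ p.
  move=> x0 y0 xy; rewrite -(mulr_powRB1 y0 p0) mulrC ler_wpM2l//.
  by rewrite ge0_ler_powR ?nnegrE// subr_ge0 ltW.
have [ac|/ltW ca] := leP `|a| `|c|.
  by rewrite (le_trans (H _ _ _ _ ac))// lerDr powR_ge0.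
rewrite -[leLHS](mulrC `|c|) -(mulr_powRB1 (normr_ge0 a) p0).
by rewrite ler_wpDr ?powR_ge0// ler_wpM2r ?powR_ge0.
Qed.

Lemma powR_normD p a c : 0 <= p ->
  `|a + c| `^ p <= 2 `^ p * (`|a| `^ p + `|c| `^ p).
Proof.
move=> p0.
have H x y : `|x| <= `|y| -> `|x + y| `^ p <= 2 `^ p * (`|x| `^ p + `|y| `^ p).
  move=> xy; rewrite (@le_trans _ _ ((2 * `|y|) `^ p))//.
    rewrite ge0_ler_powR ?nnegrE ?mulr_ge0//.
    by rewrite (le_trans (ler_normD _ _))// mulr2n mulrDl mul1r lerD2r.
  by rewrite powRM// ler_wpM2l ?powR_ge0// lerDr powR_ge0.
have [ac|/ltW ca] := leP `|a| `|c|; first exact: H.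
by rewrite addrC [X in _ * X]addrC H.
Qed.

Lemma maxr0_dist x y : `|Num.max x 0 - Num.max y 0| <= `|x - y|.
Proof.
have [x0|x0] := leP x 0; have [y0|y0] := leP y 0.
- by rewrite subrr normr0.
- rewrite sub0r normrN (gtr0_norm y0) distrC ger0_norm; lra.
- rewrite subr0 (gtr0_norm x0) ger0_norm; lra.
- by [].
Qed.

Lemma measurable_signed_pow p : measurable_fun setT (signed_pow p : R -> R).
Proof.
apply: measurable_funM => //; apply: (measurableT_comp (measurable_powR _)).
exact: normr_measurable.
Qed.

End signed_power.

(** * Scaling and size for Lebesgue measure *)

Section lebesgue_scaling.
Context {R : realType}.
Local Open Scope ereal_scope.

Lemma ge0_integral_scale1 (t : R) (f : R -> \bar R) : (0 < t)%R ->
  measurable_fun setT f -> (forall x, 0 <= f x) ->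
  \int[lebesgue_measure]_x f x = t%:E * \int[lebesgue_measure]_x f (t * x)%R.
Proof.
move=> t0 mf f0.
have mt : measurable_fun setT (fun x : measurableTypeR R => (t * x)%R : measurableTypeR R).
  exact: measurable_funM.
pose nu := mscale (NngNum (ltW t0))
  (measure_function_pushforward__canonical__measure_function_Measure
     (@lebesgue_measure R) mt).
have E A : measurable A -> lebesgue_measure A = nu A.
  apply: lebesgue_measure_unique => _ [[a b]] _ <-.
  rewrite /nu/= /mscale/= /pushforward.
  rewrite (_ : _ @^-1` _ = `]a / t, b / t]%classic)%R; last first.
    apply/seteqP; split => x /=; rewrite !in_itv/= ltr_pdivrMr// ler_pdivlMr//;
      by rewrite ![(x * t)%R]mulrC.
  rewrite !lebesgue_measure_itv/= !lte_fin ltr_pM2r ?invr_gt0//.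
  case: ifPn => _; last by rewrite mule0.
  by rewrite -!EFinD -EFinM -mulrBl mulrCA divff ?mulr1 ?gt_eqF.
rewrite (@eq_measure_integral _ _ _ setT nu); last by move=> A mA _; exact: E.
by rewrite ge0_integral_mscale// ge0_integral_pushforward.
Qed.

Lemma measurable_scale_rV n (t : R) :
  measurable_fun setT (fun x : 'rV[R]_n => (t *: x)%R).
Proof.
apply: measurable_fun_rV => i; under eq_fun do rewrite mxE.
by apply: measurable_funM => //; exact: measurable_coord_rV.
Qed.

(** Lebesgue measure on R^n is an iterated product, so the one-dimensional
    change of variables is applied to one coordinate at a time. *)
Lemma ge0_integral_scale n (t : R) (f : 'rV[R]_n -> \bar R) : (0 < t)%R ->
  measurable_fun setT f -> (forall x, 0 <= f x) ->
  \int[@lebesgue_rV R n]_x f x = (t ^+ n)%:E * \int[@lebesgue_rV R n]_x f (t *: x)%R.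
Proof.
move=> t0; elim: n f => [|n ih] f mf f0.
  rewrite expr0 mul1e; apply: eq_integral => x _; congr f.
  by apply/rowP => -[].
pose g (z : 'rV[R]_n * measurableTypeR R) := f (rV_cons z).
have mg : measurable_fun setT g by exact: measurableT_comp mf (@measurable_rV_cons R n).
have g0 z : 0 <= g z by exact: f0.
pose F z := \int[@lebesgue_measure R]_x g (z, x).
have stepE (h : 'rV[R]_n.+1 -> \bar R) : measurable_fun setT h -> (forall x, 0 <= h x) ->
    \int[@lebesgue_rV R n.+1]_x h x =
    \int[@lebesgue_rV R n]_z \int[@lebesgue_measure R]_x h (rV_cons (z, x)).
  move=> mh h0.
  transitivity (\int[(@lebesgue_rV R n \x @lebesgue_measure R)]_z h (rV_cons z)).
    rewrite {1}/lebesgue_rV/= /lebesgue_step ge0_integral_pushforward//.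
    exact: measurable_rV_cons.
  by rewrite fubini_tonelli1//; exact: measurableT_comp mh (@measurable_rV_cons R n).
rewrite stepE// (ih F); last 2 first.
- exact: (measurable_fun_fubini_tonelli_F g).
- by move=> x; exact: integral_ge0.
rewrite (stepE (fun x => f (t *: x)%R)); last 2 first.
- exact: measurableT_comp mf (@measurable_scale_rV n.+1 t).
- by move=> x; exact: f0.
have consZ z x : (t *: rV_cons (z, x) = rV_cons (t *: z, t * x))%R.
  by apply/rowP => i; rewrite !mxE; case: unliftP => [j|] _ //=; rewrite mxE.
have -> : \int[@lebesgue_rV R n]_x F (t *: x)%R = \int[@lebesgue_rV R n]_x
    (t%:E * \int[@lebesgue_measure R]_y f (t *: rV_cons (x, y))%R).
  apply: eq_integral => z _; rewrite /F (@ge0_integral_scale1 t)//; last first.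
    exact: (measurable_fun_pair2 _ mg).
  by congr (_ * _); apply: eq_integral => x _; rewrite /g consZ.
rewrite ge0_integralZl//; last 3 first.
- apply: (measurable_fun_fubini_tonelli_F (fun z => f (t *: rV_cons z)%R)) => //.
  apply: (measurableT_comp mf); apply: (measurableT_comp (measurable_scale_rV t)).
  exact: measurable_rV_cons.
- by move=> x _; exact: integral_ge0.
- by rewrite lee_fin ltW.
by rewrite muleA -EFinM exprSr.
Qed.

End lebesgue_scaling.

Section lebesgue_size.
Context {R : realType} {n : nat}.
Implicit Types (x y : 'rV[R]_n) (r : R).

Lemma norm_coord x i : `|x 0 i| <= `|x|.
Proof.
by rewrite [leRHS]mx_normrE (le_bigmax _ (fun ij => `|x ij.1 ij.2|) (ord0, i)).
Qed.

Lemma norm_rV_lt x r : 0 < r -> (forall i, `|x 0 i| < r) -> `|x| < r.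
Proof.
move=> r0 xr; rewrite [ltLHS]mx_normrE.
by apply/bigmax_ltP; split => // -[i j] _ /=; rewrite ord1.
Qed.

Lemma norm_rV_le x r : 0 <= r -> (forall i, `|x 0 i| <= r) -> `|x| <= r.
Proof.
move=> r0 xr; rewrite [leLHS]mx_normrE.
by apply/bigmax_leP; split => // -[i j] _ /=; rewrite ord1.
Qed.

(** Half-open, so that the volume formula for boxes applies. *)
Definition cube x r : set 'rV[R]_n := box (x - const_mx r) (x + const_mx r).

Lemma cubeP x r y : `|x - y| < r -> cube x r y.
Proof.
move=> xyr i; have := le_lt_trans (norm_coord (x - y) i) xyr.
rewrite !mxE ltr_norml => /andP[h1 h2]; apply/andP; split; lra.
Qed.

Lemma lebesgue_cube x r : 0 <= r -> lebesgue_rV (cube x r) = ((2 * r) ^+ n)%:E.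
Proof.
move=> r0; rewrite lebesgue_rV_box => [|i]; last by rewrite !mxE; lra.
congr (_%:E); rewrite (eq_bigr (fun=> 2 * r)) ?prodr_const ?card_ord//.
by move=> i _; rewrite !mxE; ring.
Qed.

Lemma lebesgue_ball_gt0 x r : 0 < r -> (0 < lebesgue_rV (ball x r : set 'rV[R]_n))%E.
Proof.
move=> r0; have r20 : 0 < r / 2 by rewrite divr_gt0.
apply: (@lt_le_trans _ _ (lebesgue_rV (cube x (r / 2)))).
  by rewrite lebesgue_cube ?(ltW r20)// lte_fin exprn_gt0// mulr_gt0.
apply: le_measure; rewrite ?inE; [exact: measurable_box|by apply: open_measurable_rV; exact: ball_open|].
move=> y xy; rewrite -ball_normE /ball_/=; apply: norm_rV_lt => // i.
by have := xy i; rewrite !mxE => /andP[h1 h2]; rewrite ltr_norml; apply/andP; split; lra.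
Qed.

Lemma lebesgue_bounded_lty (A : set 'rV[R]_n) : measurable A -> bounded_set A ->
  (lebesgue_rV A < +oo)%E.
Proof.
move=> mA [M [Mreal MA]].
have M10 : 0 < `|M| + 1 + 1 by rewrite ltr_wpDr.
apply: (@le_lt_trans _ _ (lebesgue_rV (cube 0 (`|M| + 1 + 1)))); last first.
  by rewrite lebesgue_cube ?ltry// ltW.
apply: le_measure; rewrite ?inE//; first exact: measurable_box.
move=> y Ay; apply: cubeP; rewrite sub0r normrN.
apply: (@le_lt_trans _ _ (`|M| + 1)); last by rewrite ltrDl.
by apply: MA => //; rewrite (le_lt_trans (ler_norm _))// ltrDl.
Qed.

End lebesgue_size.

(** * Euclidean norm and integrals of truncated kernels *)

Section euclidean_norm.
Context {R : realType} {n : nat}.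
Implicit Types (x y : 'rV[R]_n).

Lemma eucl_norm_ge0 x : 0 <= eucl_norm x.
Proof. exact: sqrtr_ge0. Qed.

Lemma le_norm_eucl x : `|x| <= eucl_norm x.
Proof.
apply: norm_rV_le => [|i]; first exact: eucl_norm_ge0.
rewrite -sqrtr_sqr ler_wsqrtr// (bigD1 i)//= lerDl.
by apply: sumr_ge0 => j _; rewrite sqr_ge0.
Qed.

Lemma le_eucl_norm x : eucl_norm x <= n%:R * `|x|.
Proof.
have nx0 : 0 <= n%:R * `|x| by rewrite mulr_ge0.
rewrite -[leRHS]ger0_norm// -sqrtr_sqr ler_wsqrtr// exprMn.
apply: (@le_trans _ _ (\sum_(i < n) `|x| ^+ 2)).
  by apply: ler_sum => i _; rewrite -real_normK ?num_real// lerXn2r ?nnegrE ?norm_coord.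
rewrite sumr_const card_ord -[leLHS]mulr_natl ler_wpM2r ?sqr_ge0//.
by rewrite -natrX ler_nat; case: n => // m; rewrite leq_pmulr.
Qed.

Lemma eucl_normN x : eucl_norm (- x) = eucl_norm x.
Proof. by congr Num.sqrt; apply: eq_bigr => i _; rewrite !mxE sqrrN. Qed.

Lemma eucl_distC x y : eucl_norm (x - y) = eucl_norm (y - x).
Proof. by rewrite -eucl_normN opprB. Qed.

Lemma eucl_normZ (t : R) x : 0 <= t -> eucl_norm (t *: x) = t * eucl_norm x.
Proof.
move=> t0; rewrite /eucl_norm -{2}(ger0_norm t0) -sqrtr_sqr -sqrtrM ?sqr_ge0//.
by congr Num.sqrt; rewrite mulr_sumr; apply: eq_bigr => i _; rewrite mxE exprMn.
Qed.

Lemma eucl_norm_gt0 x : x != 0 -> 0 < eucl_norm x.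
Proof. by move=> x0; rewrite (lt_le_trans _ (le_norm_eucl x))// normr_gt0. Qed.

Lemma measurable_eucl_dist d (T : measurableType d) (f g : T -> 'rV[R]_n) :
  measurable_fun setT f -> measurable_fun setT g ->
  measurable_fun setT (fun t => eucl_norm (f t - g t)).
Proof.
move=> mf mg.
rewrite (_ : (fun t => _) =
    (fun t => (\sum_i (f t 0 i - g t 0 i) ^+ 2) `^ 2^-1)); last first.
  apply/funext => t; rewrite powR12_sqrt; last by apply: sumr_ge0 => i _; rewrite sqr_ge0.
  by congr Num.sqrt; apply: eq_bigr => i _; rewrite !mxE.
apply: (measurableT_comp (measurable_powR _)).
apply: measurable_sum => i; apply: measurable_funX; apply: measurable_funB.
  exact: measurableT_comp (@measurable_coord_rV R n i) mf.
exact: measurableT_comp (@measurable_coord_rV R n i) mg.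
Qed.

End euclidean_norm.

Section kernel_bound.
Context {R : realType}.

(** Integral of a function that is dominated at each point by some term of a
    sequence whose integrals decay geometrically. *)
Lemma ge0_integral_le_geometric d (T : measurableType d)
    (mu : {measure set T -> \bar R}) (g : T -> \bar R) (f : nat -> T -> \bar R)
    (C r : R) : 0 <= r < 1 ->
  measurable_fun setT g -> (forall x, 0 <= g x)%E ->
  (forall k, measurable_fun setT (f k)) -> (forall k x, 0 <= f k x)%E ->
  (forall k, \int[mu]_x f k x <= (C * r ^+ k)%:E)%E ->
  (forall x, exists k, g x <= f k x)%E ->
  (\int[mu]_x g x <= (C / (1 - r))%:E)%E.
Proof.
move=> /andP[r0 r1] mg g0 mf f0 fC gf.
apply: (@le_trans _ _ (\int[mu]_x \sum_(0 <= k <oo) f k x)%E).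
  apply: ge0_le_integral => //; first exact: ge0_emeasurable_sum.
  move=> x _; have [k gk] := gf x.
  apply: (le_trans gk); apply: le_trans (nneseries_lim_ge k.+1 _) => //.
  by rewrite big_nat_recr//= leeDr// sume_ge0.
rewrite integral_nneseries//; apply: lime_le.
  by apply: is_cvg_nneseries_cond => k _ _; exact: integral_ge0.
apply: nearW => m; apply: (@le_trans _ _ (\sum_(0 <= k < m) (C * r ^+ k)%:E)%E).
  by apply: lee_sum => k _; exact: fC.
rewrite sumEFin lee_fin -mulr_sumr ler_wpM2l//.
  have := fC 0; rewrite expr0 mulr1 -lee_fin; apply: le_trans.
  by rewrite integral_ge0.
have r10 : 0 < 1 - r by rewrite subr_gt0.
rewrite -[leRHS]mul1r ler_pdivlMr// big_mkord.
have -> : (\sum_(i < m) r ^+ i) * (1 - r) = 1 - r ^+ m.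
  by rewrite -[1 - r]opprB mulrN mulrC -subrX1 opprB.
by rewrite lerBlDr lerDl exprn_ge0.
Qed.

Variable n : nat.

Lemma measurable_trunc_kernel (b c : R) (x : 'rV[R]_n) :
  measurable_fun setT (fun y : 'rV[R]_n =>
    (Num.min (eucl_norm (x - y) `^ b) 1 / eucl_norm (x - y) `^ c)%:E).
Proof.
have me : measurable_fun setT (fun y : 'rV[R]_n => eucl_norm (x - y)).
  exact: measurable_eucl_dist.
under eq_fun do rewrite -powRN.
apply/measurable_EFinP/measurable_funM.
  by apply: measurable_minr => //; exact: measurableT_comp (measurable_powR _) me.
exact: measurableT_comp (measurable_powR _) me.
Qed.

(** The weight has size [|x - y|^(b - sg - n)] near the diagonal and
    [|x - y|^(- sg - n)] far from it.  On the shells where [|x - y|] is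
    comparable to [exp (-k)] or to [exp k], contained in cubes centred at [x],
    its integral is at most a constant times [exp (-k (b - sg))] or
    [exp (-k sg)], and both series are geometric.  Centring the cubes at [x]
    makes the bound uniform in [x] without any appeal to translation
    invariance. *)
Lemma integral_trunc_kernel (b sg : R) : 0 < sg -> sg < b -> exists2 K : R, 0 <= K &
  forall x : 'rV[R]_n, (\int[@lebesgue_rV R n]_y
    (Num.min (eucl_norm (x - y) `^ b) 1 /
     eucl_norm (x - y) `^ (n%:R + sg))%:E <= K%:E)%E.
Proof.
move=> sg0 sgb; set c := n%:R + sg.
have c0 : 0 < c by rewrite ltr_wpDl.
pose r := Num.max (expR (sg - b)) (expR (- sg)).
pose C := 4 ^+ n * (expR c + expR n%:R).
have r0 : 0 <= r by rewrite le_max expR_ge0.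
have r1 : r < 1 by rewrite gt_max !expR_lt1 subr_lt0 sgb oppr_lt0 sg0.
exists (C / (1 - r)) => [|x].
  by rewrite divr_ge0 ?subr_ge0 ?(ltW r1)// mulr_ge0 ?exprn_ge0 ?addr_ge0 ?expR_ge0.
pose a k : R := expR (- k%:R * b + k.+1%:R * c).
pose a' k : R := expR (- k%:R * c).
pose A k : set 'rV[R]_n := cube x (2 * expR (- k%:R)).
pose A' k : set 'rV[R]_n := cube x (2 * expR k.+1%:R).
have mA k : measurable (A k) by exact: measurable_box.
have mA' k : measurable (A' k) by exact: measurable_box.
have mi (B : set 'rV[R]_n) (z : R) : measurable B ->
    measurable_fun setT (fun y => (z%:E * (\1_B y)%:E)%E).
  by move=> mB; apply: measurable_funeM; apply/measurable_EFinP; exact: measurable_indic.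
have i0 (B : set 'rV[R]_n) (z : R) y : 0 <= z -> (0 <= z%:E * (\1_B y)%:E)%E.
  by move=> z0; rewrite mule_ge0 ?lee_fin.
have vol (z : R) : lebesgue_rV (cube x (2 * expR z)) = (4 ^+ n * expR (n%:R * z))%:E.
  rewrite lebesgue_cube ?mulr_ge0 ?expR_ge0// mulrA exprMn expRM_natl.
  by congr (_ ^+ _ * _)%:E; ring.
apply: (@ge0_integral_le_geometric _ _ _ _
  (fun k y => (a k)%:E * (\1_(A k) y)%:E + (a' k)%:E * (\1_(A' k) y)%:E)%E).
- by rewrite r0.
- exact: measurable_trunc_kernel.
- by move=> y; rewrite lee_fin divr_ge0 ?powR_ge0// le_min powR_ge0/=.
- by move=> k; apply: emeasurable_funD; exact: mi.
- by move=> k y; rewrite adde_ge0 ?i0 ?expR_ge0.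
- move=> k; rewrite ge0_integralD//; last 4 first.
  + by move=> y _; rewrite i0 ?expR_ge0.
  + exact: mi.
  + by move=> y _; rewrite i0 ?expR_ge0.
  + exact: mi.
  rewrite !ge0_integralZl_EFin ?expR_ge0//; last 2 first.
  + by apply/measurable_EFinP; exact: measurable_indic.
  + by apply/measurable_EFinP; exact: measurable_indic.
  rewrite !integral_indic// !setIT [_ (A k)]vol [_ (A' k)]vol -!EFinM -EFinD lee_fin.
  rewrite /a /a' mulrCA -expRD mulrCA -expRD -mulrDr /C -mulrA ler_wpM2l ?exprn_ge0//.
  rewrite mulrDl lerD//.
    rewrite (_ : _ + _ = c + k%:R * (sg - b)).
      rewrite expRD expRM_natl ler_wpM2l ?expR_ge0//.
      by rewrite lerXn2r ?nnegrE ?expR_ge0// le_max lexx.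
    by rewrite -natr1 /c; ring.
  rewrite (_ : _ + _ = n%:R + k%:R * (- sg)).
    rewrite expRD expRM_natl ler_wpM2l ?expR_ge0//.
    by rewrite lerXn2r ?nnegrE ?expR_ge0// le_max lexx orbT.
  by rewrite -natr1 /c; ring.
move=> y; set e := eucl_norm (x - y).
have [e0|] := eqVneq e 0.
  exists 0; rewrite e0 (powR0 (lt0r_neq0 c0)) invr0 mulr0.
  by rewrite adde_ge0 ?i0 ?expR_ge0.
move=> en0; have {en0}e0 : 0 < e by rewrite lt_def en0 eucl_norm_ge0.
have xy : `|x - y| <= e by exact: le_norm_eucl.
have eE : e = expR (ln e) by rewrite lnK.
have powE z : e `^ z = expR (z * ln e) by rewrite /powR gt_eqF.
have two (z : R) : 0 < z -> z < 2 * z by move=> z0; rewrite ltr_pMl// ltr1n.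
have [e1|e1] := leP e 1.
  pose k := Num.truncn (- ln e).
  have k1 : k%:R <= - ln e by rewrite truncn_le// oppr_ge0 ln_le0.
  have k2 : - ln e < k.+1%:R by exact: truncnS_gt.
  exists k; have Ay : A k y.
    apply: cubeP; rewrite (le_lt_trans xy)// (le_lt_trans _ (two _ (expR_gt0 _)))//.
    by rewrite eE ler_expR lerNr.
  rewrite [\1_(A k) y]indicE mem_set// mule1.
  apply: (@le_trans _ _ (a k)%:E); last by rewrite leeDl// i0 ?expR_ge0.
  rewrite lee_fin (@le_trans _ _ (e `^ b / e `^ c))//.
    by rewrite ler_wpM2r ?invr_ge0 ?powR_ge0// ge_min lexx.
  rewrite -powRN !powE -expRD ler_expR lerD//.
    by rewrite mulrC ler_pM2r ?(lt_trans sg0)// lerNr.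
  by rewrite mulNr -mulrN mulrC ler_pM2r// ltW.
pose k := Num.truncn (ln e).
have k1 : k%:R <= ln e by rewrite truncn_le// ln_ge0// ltW.
have k2 : ln e < k.+1%:R by exact: truncnS_gt.
exists k; have Ay : A' k y.
  apply: cubeP; rewrite (le_lt_trans xy)// (le_lt_trans _ (two _ (expR_gt0 _)))//.
  by rewrite eE ler_expR ltW.
rewrite [\1_(A' k) y]indicE mem_set// mule1.
apply: (@le_trans _ _ (a' k)%:E); last by rewrite leeDr// i0 ?expR_ge0.
rewrite lee_fin (@le_trans _ _ (1 / e `^ c))//.
  by rewrite ler_wpM2r ?invr_ge0 ?powR_ge0// ge_min lexx orbT.
by rewrite mul1r -powRN !powE ler_expR !mulNr lerN2 mulrC ler_pM2l.
Qed.

End kernel_bound.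

(** * Double integrals and energies *)

Section rV_functions.
Context {R : realType} {n : nat}.

Lemma continuous_measurable_rV (f : 'rV[R]_n -> R) :
  continuous f -> measurable_fun setT f.
Proof.
move=> cf; apply: (measurability _ (RGenOInfty.measurableE R)).
move=> _ [_ [a ->] <-]; rewrite setTI; apply: open_measurable_rV.
by apply: open_comp => [x _|]; [exact: cf|exact: interval_open].
Qed.

Lemma compact_closure_bounded (A : set 'rV[R]_n) : bounded_set A -> compact (closure A).
Proof.
move=> [M [_ MA]]; apply: bounded_closed_compact; last exact: closed_closure.
pose B := @closed_ball_ R 'rV[R]_n Num.Def.normr 0 (M + 1).
have AB : closure A `<=` B.
  rewrite closureE; apply: smallest_sub; first exact: closed_closed_ball_.
  by move=> x Ax; rewrite /B/closed_ball_/= sub0r normrN MA// ltrDl.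
exists (M + 1); split; first exact: num_real.
move=> x Mx y /AB; rewrite /B/closed_ball_/= sub0r normrN => yM.
by rewrite (le_trans yM)// ltW.
Qed.

End rV_functions.

Section double_integrals.
Context {R : realType} {n : nat}.
Local Notation mu := (@lebesgue_rV R n).
Local Notation mu2 := (mu \x mu)%E.
Local Notation V2 := ('rV[R]_n * 'rV[R]_n)%type.
Implicit Types (f : V2 -> \bar R) (t : R).
Local Open Scope ereal_scope.

Lemma integrable_swap f : mu2.-integrable setT f ->
  mu2.-integrable setT (fun z => f (z.2, z.1)).
Proof.
move=> fi; have mf := measurable_int _ fi.
have mf' : measurable_fun setT (fun z : V2 => f (z.2, z.1)).
  by apply: (measurableT_comp mf); exact: measurable_swap.
by apply/(integrable12ltyP _ _ mf'); apply/(integrable21ltyP _ _ mf).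
Qed.

Lemma ge0_integral_swap f : measurable_fun setT f -> (forall z, 0 <= f z) ->
  \int[mu2]_z f (z.2, z.1) = \int[mu2]_z f z.
Proof.
move=> mf f0; rewrite [RHS]fubini_tonelli2// fubini_tonelli1//.
by apply: (measurableT_comp mf); exact: measurable_swap.
Qed.

Definition dilation t (z : V2) : V2 := (t *: z.1, t *: z.2)%R.

Lemma measurable_dilation t : measurable_fun setT (dilation t).
Proof.
apply: measurable_fun_pair; apply: (measurableT_comp (@measurable_scale_rV R n t)).
  exact: measurable_fst.
exact: measurable_snd.
Qed.

Lemma ge0_integral_dilation t f : (0 < t)%R ->
  measurable_fun setT f -> (forall z, 0 <= f z) ->
  \int[mu2]_z f z = (t ^+ n * t ^+ n)%:E * \int[mu2]_z f (dilation t z).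
Proof.
move=> t0 mf f0.
pose g := f \o dilation t.
have mg : measurable_fun setT g by exact: measurableT_comp mf (@measurable_dilation t).
have g0 z : 0 <= g z by exact: f0.
pose F x := \int[mu]_y f (x, y).
have mF : measurable_fun setT F by exact: (measurable_fun_fubini_tonelli_F f mf f0).
have F0 x : 0 <= F x by exact: integral_ge0.
have scaleF x : F (t *: x)%R = (t ^+ n)%:E * \int[mu]_y g (x, y).
  exact: (ge0_integral_scale t0 (measurable_fun_pair2 _ mf) (fun y => f0 (_, y))).
rewrite (fubini_tonelli1 f mf f0) (fubini_tonelli1 g mg g0).
transitivity (\int[mu]_x F x); first by [].
rewrite (ge0_integral_scale t0 mF F0) EFinM -muleA; congr (_ * _).
rewrite -ge0_integralZl_EFin ?exprn_ge0 ?(ltW t0)//; last 2 first.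
- by move=> x _; exact: integral_ge0.
- exact: (measurable_fun_fubini_tonelli_F g mg g0).
by apply: eq_integral => x _; exact: scaleF.
Qed.

Lemma integrable_dilation t f : (0 < t)%R -> mu2.-integrable setT f ->
  mu2.-integrable setT (f \o dilation t).
Proof.
move=> t0 fi; have mf := measurable_int _ fi.
apply/integrableP; split; first exact: measurableT_comp mf (@measurable_dilation t).
case/integrableP : fi => _; rewrite (@ge0_integral_dilation t)//; last first.
  exact: measurableT_comp.
have tn0 : (0 < t ^+ n * t ^+ n)%R by rewrite mulr_gt0 ?exprn_gt0.
rewrite /=; set I := integral _ _ _ => Ioo.
rewrite -(mul1e I) -(mulVf (lt0r_neq0 tn0)) EFinM -muleA.
by rewrite lte_mul_pinfty ?lee_fin ?invr_ge0 ?(ltW tn0).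
Qed.

Lemma integral_dilation t f : (0 < t)%R -> mu2.-integrable setT f ->
  \int[mu2]_z f z = (t ^+ n * t ^+ n)%:E * \int[mu2]_z f (dilation t z).
Proof.
move=> t0 fi; have mf := measurable_int _ fi.
have fdi := integrable_dilation t0 fi.
have dE : \int[mu2]_z f (dilation t z) =
    \int[mu2]_z f^\+ (dilation t z) - \int[mu2]_z f^\- (dilation t z).
  by rewrite [LHS](integralE _ _ (f \o dilation t)) funepos_comp funeneg_comp.
have := integrable_add_def measurableT fdi; rewrite funepos_comp funeneg_comp => dD.
rewrite dE muleBr// -(ge0_integral_dilation t0)//; last exact: measurable_funepos.
by rewrite -(ge0_integral_dilation t0) -?integralE//; exact: measurable_funeneg.
Qed.

End double_integrals.

Section energy.
Context {R : realType} {N : nat} (s p : R).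
Hypothesis p1 : 1 < p.
Local Notation mu := (@lebesgue_rV R N).
Local Notation mu2 := (mu \x mu)%E.
Local Notation V := 'rV[R]_N.
Implicit Types (u v w phi : V -> R) (D : set V) (z : V * V).

Definition frac_kernel z : R := (eucl_norm (z.1 - z.2) `^ (N%:R + s * p))^-1.

Lemma frac_kernel_ge0 z : 0 <= frac_kernel z.
Proof. by rewrite invr_ge0 powR_ge0. Qed.

Lemma frac_kernel_swap z : frac_kernel (z.2, z.1) = frac_kernel z.
Proof. by rewrite /frac_kernel/= eucl_distC. Qed.

Lemma frac_kernel_dilation t z : 0 < t ->
  frac_kernel (dilation t z) = (t `^ (N%:R + s * p))^-1 * frac_kernel z.
Proof.
move=> t0; rewrite /frac_kernel/= -scalerBr eucl_normZ ?(ltW t0)//.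
by rewrite powRM ?(ltW t0) ?eucl_norm_ge0// invfM.
Qed.

Lemma measurable_frac_kernel : measurable_fun setT frac_kernel.
Proof.
rewrite (_ : frac_kernel = fun z => eucl_norm (z.1 - z.2) `^ (- (N%:R + s * p))); last first.
  by apply/funext => z; rewrite powRN.
apply: (measurableT_comp (measurable_powR _)).
by apply: measurable_eucl_dist; [exact: measurable_fst|exact: measurable_snd].
Qed.

Definition incr u z : R := u z.1 - u z.2.

Lemma measurable_incr u : measurable_fun setT u -> measurable_fun setT (incr u).
Proof.
move=> mu_; apply: measurable_funB.
  exact: measurableT_comp mu_ measurable_fst.
exact: measurableT_comp mu_ measurable_snd.
Qed.

Definition gagliardo_density u z : R := `|incr u z| `^ p * frac_kernel z.

Lemma gagliardo_density_ge0 u z : 0 <= gagliardo_density u z.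
Proof. by rewrite mulr_ge0 ?powR_ge0 ?frac_kernel_ge0. Qed.

Lemma gagliardo_density_swap u z : gagliardo_density u (z.2, z.1) = gagliardo_density u z.
Proof. by rewrite /gagliardo_density frac_kernel_swap /incr/= distrC. Qed.

Lemma measurable_gagliardo_density u : measurable_fun setT u -> measurable_fun setT (gagliardo_density u).
Proof.
move=> mu_; apply: measurable_funM; last exact: measurable_frac_kernel.
apply: (measurableT_comp (measurable_powR _)).
exact: measurableT_comp (measurable_incr mu_).
Qed.

Lemma measurable_indic1 D : measurable D ->
  measurable_fun setT (fun z : V * V => \1_D z.1 : R).
Proof.
move=> mD; apply: (measurableT_comp _ measurable_fst); exact: measurable_indic.
Qed.

Lemma gagliardo_integrable D u : measurable D -> measurable_fun setT u ->
  (gagliardo s p D u < +oo)%E <->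
  mu2.-integrable setT (fun z => (\1_D z.1 * gagliardo_density u z)%:E).
Proof.
move=> mD mu_.
have mf : measurable_fun setT (fun z => (\1_D z.1 * gagliardo_density u z)%:E).
  apply/measurable_EFinP/measurable_funM; first exact: measurable_indic1.
  exact: measurable_gagliardo_density.
rewrite (integrable12ltyP _ _ mf) /gagliardo integral_mkcond.
suff -> : (\int[mu]_x ((fun x => \int[mu]_y
      (`|u x - u y| `^ p / eucl_norm (x - y) `^ (N%:R + s * p))%:E) \_ D) x =
    \int[mu]_x \int[mu]_y `|(\1_D x * gagliardo_density u (x, y))%:E|)%E by [].
apply: eq_integral => x _; rewrite patchE; case: ifPn => xD.
  apply: eq_integral => y _; rewrite indicE xD mul1r gee0_abs// lee_fin.
  exact: gagliardo_density_ge0.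
rewrite integral0_eq// => y _; rewrite indicE (negbTE xD) mul0r.
by rewrite abse0.
Qed.

Definition form_density u phi z : R := signed_pow p (incr u z) * incr phi z * frac_kernel z.

(** If [phi] vanishes off [D], the density is supported on
    [D x V] and [V x D]; there the Young inequality bounds it by the energy
    densities of [u] and of [phi]. *)
Lemma form_density_integrable D u phi : measurable D ->
  measurable_fun setT u -> measurable_fun setT phi ->
  (gagliardo s p D u < +oo)%E -> (gagliardo s p setT phi < +oo)%E ->
  (forall x, ~ D x -> phi x = 0) ->
  mu2.-integrable setT (EFin \o form_density u phi).
Proof.
move=> mD mu_ mphi /(gagliardo_integrable mD mu_) ui
  /(gagliardo_integrable measurableT mphi) phii phi0.
have mf : measurable_fun setT (form_density u phi).
  apply: measurable_funM; last exact: measurable_frac_kernel.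
  apply: measurable_funM; last exact: measurable_incr.
  exact: measurableT_comp (@measurable_signed_pow _ p) (measurable_incr mu_).
have := integrableD measurableT (integrableD measurableT ui (integrable_swap ui)) phii.
apply: le_integrable => //; first exact/measurable_EFinP.
move=> z _ /=; rewrite gagliardo_density_swap lee_fin.
rewrite [leRHS]ger0_norm; last first.
  by rewrite !addr_ge0// mulr_ge0 ?gagliardo_density_ge0.
have [Dz|nDz] := pselect (D z.1 \/ D z.2); last first.
  have -> : form_density u phi z = 0.
    rewrite /form_density /incr !phi0 ?subrr ?mulr0 ?mul0r// => Dz; apply: nDz.
      by right.
    by left.
  by rewrite normr0 !addr_ge0// mulr_ge0 ?gagliardo_density_ge0.
rewrite /form_density normrM (ger0_norm (frac_kernel_ge0 _)).
apply: (@le_trans _ _ ((`|incr u z| `^ p + `|incr phi z| `^ p) * frac_kernel z)).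
  by rewrite ler_wpM2r ?frac_kernel_ge0 ?signed_pow_young.
rewrite mulrDl lerD//; last by rewrite indicT mul1r.
rewrite -mulrDl ler_peMl ?gagliardo_density_ge0//.
by case: Dz => Dz; rewrite !indicE (mem_set Dz) ?lerDl ?lerDr.
Qed.

Lemma frac_plap_formE u phi : mu2.-integrable setT (EFin \o form_density u phi) ->
  (frac_plap_form s p u phi = \int[mu2]_z (form_density u phi z)%:E)%E.
Proof. by move=> /integral12_prod_meas1 <-. Qed.

Lemma form_density_dilation t u phi z : 0 < t ->
  form_density (fun x => u (t *: x)) phi z =
  t `^ (N%:R + s * p) * form_density u (fun x => phi (t^-1 *: x)) (dilation t z).
Proof.
move=> t0; rewrite /form_density frac_kernel_dilation// /incr/=.
rewrite !scalerA mulVf ?gt_eqF// !scale1r.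
rewrite [RHS]mulrCA; congr (_ * _).
by rewrite mulrA divff ?mul1r// gt_eqF// powR_gt0.
Qed.

End energy.

Section gagliardo_estimates.
Context {R : realType} {N : nat} (s p : R).
Hypotheses (sp0 : 0 < s * p) (p1 : 1 < p).
Local Notation mu := (@lebesgue_rV R N).
Local Notation mu2 := (mu \x mu)%E.
Local Notation V := 'rV[R]_N.
Implicit Types (u v w phi f : V -> R) (A D : set V).

Let p0 : 0 < p. Proof. exact: lt_trans p1. Qed.

Lemma gagliardo_subset A D u : measurable A -> measurable D -> A `<=` D ->
  measurable_fun setT u -> (gagliardo s p D u < +oo)%E -> (gagliardo s p A u < +oo)%E.
Proof.
move=> mA mD AD mu_ /(gagliardo_integrable _ _ mD mu_) ui.
apply/(gagliardo_integrable _ _ mA mu_); apply: le_integrable ui => //.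
  apply/measurable_EFinP/measurable_funM; first exact: measurable_indic1.
  exact: measurable_gagliardo_density.
move=> z _ /=; rewrite lee_fin !ger0_norm ?mulr_ge0 ?powR_ge0 ?frac_kernel_ge0//.
rewrite ler_wpM2r ?gagliardo_density_ge0// !indicE; case: (boolP (z.1 \in A)) => [/set_mem Az|_].
  by rewrite mem_set//; exact: AD.
by rewrite ler0n.
Qed.

Lemma gagliardo_scaled D u (t : R) : 0 < t -> measurable D -> measurable_fun setT u ->
  (gagliardo s p D u < +oo)%E ->
  (gagliardo s p [set x : V | D (t *: x)] (fun x : V => u (t *: x)) < +oo)%E.
Proof.
move=> t0 mD mu_ /(gagliardo_integrable _ _ mD mu_) ui.
have mDt : measurable [set x : V | D (t *: x)].
  by rewrite -[X in measurable X]setTI; exact: measurable_scale_rV.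
have mut : measurable_fun setT (fun x : V => u (t *: x)).
  exact: measurableT_comp mu_ (@measurable_scale_rV R N t).
apply/(gagliardo_integrable _ _ mDt mut).
have := integrableZl measurableT (t `^ (N%:R + s * p)) (integrable_dilation t0 ui).
apply: eq_integrable => // z _ /=; rewrite -EFinM; congr EFin.
have -> : \1_[set x : V | D (t *: x)] z.1 = \1_D (t *: z.1) :> R.
  by rewrite !indicE; congr (_%:R); apply/idP/idP; rewrite !inE.
rewrite /gagliardo_density frac_kernel_dilation// mulrCA; congr (_ * _).
rewrite mulrCA; congr (_ * _).
by rewrite mulrA divff ?mul1r// gt_eqF// powR_gt0.
Qed.

(** The [p]-th power of an increment is at most a multiple of
    [min (|x - y|^p, 1)], and [s p < p]. *)
Lemma gagliardo_lipschitz A v (L : R) : s * p < p -> measurable A -> (mu A < +oo)%E ->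
  measurable_fun setT v -> 0 <= L ->
  (forall x y, `|v x - v y| <= 1) -> (forall x y, `|v x - v y| <= L * eucl_norm (x - y)) ->
  (gagliardo s p A v < +oo)%E.
Proof.
move=> spp mA Aoo mv L0 v1 vL; have [K K0 KP] := integral_trunc_kernel N sp0 spp.
have mc x : measurable_fun setT (fun y : V =>
    (Num.min (eucl_norm (x - y) `^ p) 1 / eucl_norm (x - y) `^ (N%:R + s * p))%:E).
  exact: measurable_trunc_kernel.
have c0 (x y : V) : (0 <= (Num.min (eucl_norm (x - y) `^ p) 1 /
    eucl_norm (x - y) `^ (N%:R + s * p))%:E)%E.
  by rewrite lee_fin divr_ge0 ?powR_ge0// le_min powR_ge0/=.
have Lp0 : 0 <= L `^ p + 1 by rewrite addr_ge0 ?powR_ge0.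
have mg : measurable_fun setT (fun z => (gagliardo_density s p v z)%:E).
  by apply/measurable_EFinP; exact: measurable_gagliardo_density.
apply: (@le_lt_trans _ _ (\int[mu]_(x in A) ((L `^ p + 1) * K)%:E)%E); last first.
  by rewrite integral_cst// lte_mul_pinfty// lee_fin mulr_ge0.
rewrite /gagliardo; apply: ge0_le_integral => //.
- by move=> x _; apply: integral_ge0 => y _; rewrite lee_fin (gagliardo_density_ge0 s p v (x, y)).
- apply: measurable_funTS.
  apply: (measurable_fun_fubini_tonelli_F (fun z => (gagliardo_density s p v z)%:E)) => // z.
  by rewrite lee_fin gagliardo_density_ge0.
- move=> x _; rewrite EFinM; apply: le_trans (lee_wpmul2l _ (KP x)); last by rewrite lee_fin.
  rewrite -ge0_integralZl_EFin//.
  apply: ge0_le_integral => //.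
  + by move=> y _; rewrite lee_fin (gagliardo_density_ge0 s p v (x, y)).
  + exact: (measurable_fun_pair2 _ mg).
  + by apply: measurable_funeM; exact: mc.
  move=> y _; rewrite -EFinM lee_fin mulrA ler_wpM2r ?invr_ge0 ?powR_ge0//.
  rewrite minr_pMr// le_min mulr1; apply/andP; split.
    rewrite (@le_trans _ _ (L `^ p * eucl_norm (x - y) `^ p))//; last first.
      by rewrite ler_wpM2r ?powR_ge0// lerDl.
    rewrite -powRM ?eucl_norm_ge0// ge0_ler_powR ?nnegrE ?(ltW p0)//.
    by rewrite mulr_ge0 ?eucl_norm_ge0.
  rewrite (@le_trans _ _ 1)//; last by rewrite lerDr powR_ge0.
  by rewrite (le_trans (ge0_ler_powR (ltW p0) _ _ (v1 x y))) ?nnegrE ?powR1.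
Qed.

(** Off [A x V] and [V x A] the increments of [w] vanish, so the energies of
    the [f]'s over [A] control the energy of [w] over the whole space. *)
Lemma gagliardo_pospart A f1 f2 f3 w : measurable A ->
  measurable_fun setT f1 -> measurable_fun setT f2 -> measurable_fun setT f3 ->
  measurable_fun setT w ->
  (gagliardo s p A f1 < +oo)%E -> (gagliardo s p A f2 < +oo)%E ->
  (gagliardo s p A f3 < +oo)%E ->
  (forall x, ~ A x -> w x = 0) ->
  (forall x y, `|w x - w y| <= `|(f1 x - f1 y) + ((f2 x - f2 y) - (f3 x - f3 y))|) ->
  (gagliardo s p setT w < +oo)%E.
Proof.
move=> mA m1 m2 m3 mw g1 g2 g3 wA wf.
have int1 f : measurable_fun setT f -> (gagliardo s p A f < +oo)%E ->
    mu2.-integrable setT (fun z => (\1_A z.1 * gagliardo_density s p f z + \1_A z.2 * gagliardo_density s p f z)%:E).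
  move=> mf /(gagliardo_integrable _ _ mA mf) fi.
  have := integrableD measurableT fi (integrable_swap fi).
  by apply: eq_integrable; [exact: measurableT|move=> z _; rewrite /= gagliardo_density_swap].
apply/(gagliardo_integrable _ _ measurableT mw).
pose C := 2 `^ p * (1 + 2 `^ p).
have i3 := integrableD measurableT (int1 _ m1 g1)
  (integrableD measurableT (int1 _ m2 g2) (int1 _ m3 g3)).
have := integrableZl measurableT C i3; apply: le_integrable => //.
  apply/measurable_EFinP; apply: measurable_funM; first exact: measurable_indic1.
  exact: measurable_gagliardo_density.
move=> z _ /=; rewrite lee_fin indicT mul1r.
have two0 : 0 <= 2 `^ p :> R by exact: powR_ge0.
have ind0 f (x : V) : 0 <= \1_A x * gagliardo_density s p f z by rewrite !mulr_ge0 ?powR_ge0 ?frac_kernel_ge0.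
have C0 : 0 <= C by rewrite mulr_ge0 ?addr_ge0.
have S0 : 0 <= \1_A z.1 * gagliardo_density s p f1 z + \1_A z.2 * gagliardo_density s p f1 z +
    (\1_A z.1 * gagliardo_density s p f2 z + \1_A z.2 * gagliardo_density s p f2 z +
     (\1_A z.1 * gagliardo_density s p f3 z + \1_A z.2 * gagliardo_density s p f3 z)).
  by rewrite !addr_ge0.
rewrite ger0_norm ?gagliardo_density_ge0// ger0_norm ?(mulr_ge0 C0 S0)//.
have [Az|nAz] := pselect (A z.1 \/ A z.2); last first.
  rewrite /gagliardo_density /incr !wA; last 2 first.
  - by move=> ?; apply: nAz; right.
  - by move=> ?; apply: nAz; left.
  by rewrite subrr normr0 powR0 ?gt_eqF// mul0r (mulr_ge0 C0 S0).
have one f : gagliardo_density s p f z <= \1_A z.1 * gagliardo_density s p f z + \1_A z.2 * gagliardo_density s p f z.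
  rewrite -mulrDl ler_peMl ?gagliardo_density_ge0//.
  by case: Az => Az; rewrite !indicE (mem_set Az) ?lerDl ?lerDr.
apply: (@le_trans _ _ (C * (gagliardo_density s p f1 z + (gagliardo_density s p f2 z + gagliardo_density s p f3 z)))); last first.
  by rewrite ler_wpM2l// lerD// lerD.
rewrite /gagliardo_density -!mulrDl mulrA ler_wpM2r ?frac_kernel_ge0//.
rewrite (@le_trans _ _ (`|incr f1 z + (incr f2 z - incr f3 z)| `^ p))//.
  by rewrite ge0_ler_powR ?nnegrE ?(ltW p0)//; exact: wf.
rewrite (le_trans (powR_normD _ _ (ltW p0)))// /C -mulrA ler_wpM2l//.
apply: (@le_trans _ _ (`|incr f1 z| `^ p +
    2 `^ p * (`|incr f2 z| `^ p + `|incr f3 z| `^ p))).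
  by rewrite lerD2l -[`|incr f3 z|]normrN powR_normD// ltW.
rewrite mulrDr; apply: lerD; first by rewrite ler_peMl ?powR_ge0// lerDl.
by rewrite ler_wpM2r ?addr_ge0 ?powR_ge0// lerDr.
Qed.

End gagliardo_estimates.

(** * The equation tested against positive parts *)

Section scaled_equation.
Context {R : realType} {N : nat} (s p : R).
Hypotheses (sp0 : 0 < s * p) (p1 : 1 < p).
Local Notation mu := (@lebesgue_rV R N).
Local Notation mu2 := (mu \x mu)%E.
Local Notation V := 'rV[R]_N.
Implicit Types (u v w phi f : V -> R) (D : set V).

(** For bounded open [D] such functions are admissible in the weak formulation;
    the upper bound makes the potential terms finite. *)
Definition test_function D w := [/\ measurable_fun setT w,
  (forall x, 0 <= w x), (exists M, forall x, w x <= M),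
  (forall x, ~ D x -> w x = 0) & (gagliardo s p setT w < +oo)%E].

Lemma bounded_support_integrable D f M : open D -> bounded_set D ->
  measurable_fun setT f -> (forall x, `|f x| <= M) -> (forall x, ~ D x -> f x = 0) ->
  mu.-integrable setT (EFin \o f).
Proof.
move=> oD bD mf fM f0.
have mD : measurable D by exact: open_measurable_rV.
rewrite (_ : EFin \o f = (EFin \o f) \_ D); last first.
  apply/funext => x; rewrite patchE; case: ifPn => // /negP; rewrite inE => Dx.
  by rewrite /= f0.
apply/(integrable_mkcond _ mD); apply: measurable_bounded_integrable => //.
- exact: lebesgue_bounded_lty.
- exact: measurable_funTS.
exists M; split; first exact: num_real.
by move=> K MK x _; apply: le_trans (fM x) _; exact: ltW.
Qed.

Lemma test_function_Wsp0 D w : open D -> bounded_set D -> test_function D w ->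
  Wsp0 s p D w /\ compact (closure [set x | w x != 0]).
Proof.
move=> oD bD [mw w0 [M wM] wD gw]; have p0 : 0 < p by rewrite (lt_trans ltr01).
split; last first.
  apply: compact_closure_bounded; move: bD => [K [Kr KD]]; exists K; split => //.
  move=> x Kx y /= wy; apply: KD => //.
  by apply: contrapT => /wD wy0; rewrite wy0 eqxx in wy.
split; last first.
  by exists set0; split => // x /=; apply: contra_notP => _ Dx; exact: wD.
split => //; apply/andP; split; first by rewrite inE.
rewrite inE/= /finite_norm unlock/=; apply: poweR_lty.
have mwp : measurable_fun setT (fun x => `|w x| `^ p).
  by apply: (measurableT_comp (measurable_powR _)); exact: measurableT_comp.
have /integrableP[_] : mu.-integrable setT (EFin \o (fun x => `|w x| `^ p)).
  apply: (@bounded_support_integrable D _ (M `^ p)) => // x.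
    rewrite ger0_norm ?powR_ge0// ge0_ler_powR ?nnegrE ?(ltW p0)//.
      exact: le_trans (wM x).
    by rewrite ger0_norm.
  by move=> /wD ->; rewrite normr0 powR0// gt_eqF.
apply: le_lt_trans; apply: ge0_le_integral => //=.
- exact/measurable_EFinP.
- by apply/measurable_EFinP; exact: measurableT_comp.
- by move=> x _; rewrite lee_fin ler_norm.
Qed.

Variables (D0 D1 : set V) (q u : V -> R) (t : R).
Local Notation D := (D0 `\` closure D1).
Hypotheses (oD0 : open D0) (bD0 : bounded_set D0).
Hypotheses (q0 : forall x, D x -> 0 <= q x) (mq : measurable_fun D q)
  (bq : [bounded q x | x in D]).
Hypotheses (cu : continuous u) (u01 : forall x, 0 <= u x <= 1)
  (wu : weak_solution s p D0 D1 q u).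
Hypotheses (t0 : 0 < t) (qt : forall x, D x -> D (t *: x) ->
  q x <= t `^ (s * p) * q (t *: x)).

Lemma annulus_open : open D.
Proof. by rewrite setDE; apply: openI => //; apply: closed_openC; exact: closed_closure. Qed.

Lemma annulus_bounded : bounded_set D.
Proof. by move: bD0 => [M [Mr MD]]; exists M; split => // x Mx y [Dy _]; exact: MD Dy. Qed.

Let mD : measurable D.
Proof. by apply: open_measurable_rV; exact: annulus_open. Qed.

Let mu_ : measurable_fun setT u.
Proof. exact: continuous_measurable_rV. Qed.

Let gu : (gagliardo s p D u < +oo)%E.
Proof. by case: wu => -[]. Qed.

Let Q := q \_ D.

Let mQ : measurable_fun setT Q.
Proof. exact/(measurable_restrictT _ mD). Qed.

Let Q0 x : 0 <= Q x.
Proof. by rewrite /Q patchE; case: ifPn => // /set_mem; exact: q0. Qed.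

Let QM : exists2 M, 0 <= M & forall x, Q x <= M.
Proof.
case: bq => M [_ /(_ (`|M| + 1))]; rewrite ltr_pwDr ?ler_norm// => /(_ isT) qM.
exists (`|M| + 1) => [|x]; first by rewrite addr_ge0.
rewrite /Q patchE; case: ifPn => [/set_mem Dx|_]; last by rewrite addr_ge0.
exact: le_trans (ler_norm _) (qM _ Dx).
Qed.

Local Notation J := (signed_pow p).

Let J01 x : 0 <= x <= 1 -> 0 <= J x <= 1.
Proof.
move=> /andP[x0 x1]; rewrite signed_powE// powR_ge0/=.
have p10 : 0 <= p - 1 by rewrite subr_ge0 ltW.
by rewrite (le_trans (ge0_ler_powR p10 _ _ x1)) ?nnegrE ?powR1.
Qed.

Let QJ_integrable v w : measurable_fun setT v -> (forall x, 0 <= v x <= 1) ->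
  test_function D w -> mu.-integrable setT (EFin \o (fun x => Q x * J (v x) * w x)).
Proof.
move=> mv v01 [mw w0 [M wM] wD _]; case: QM => K K0 QK.
apply: (@bounded_support_integrable D _ (K * M)) => //.
- exact: annulus_open.
- exact: annulus_bounded.
- apply: measurable_funM => //; apply: measurable_funM => //.
  exact: measurableT_comp (@measurable_signed_pow _ p) mv.
- move=> x; have /andP[] := J01 (v01 x); move: (J (v x)) => j j0 j1.
  rewrite ger0_norm ?mulr_ge0 ?Q0 ?w0//.
  by rewrite ler_pM ?mulr_ge0 ?Q0 ?w0 ?wM// -[leRHS]mulr1 ler_pM ?Q0 ?QK.
by move=> x /wD ->; rewrite mulr0.
Qed.

Let integral_Q f : (\int[mu]_(x in D) (q x * f x)%:E = \int[mu]_x (Q x * f x)%:E)%E.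
Proof.
rewrite integral_mkcond; apply: eq_integral => x _.
by rewrite /Q !patchE; case: ifPn => // _; rewrite mul0r.
Qed.

Let weak_eq w : test_function D w -> mu2.-integrable setT (EFin \o form_density s p u w) /\
  (\int[mu2]_z (form_density s p u w z)%:E + \int[mu]_x (Q x * J (u x) * w x)%:E = 0)%E.
Proof.
move=> tw; have [mw w0 _ wD gw] := tw.
have fi : mu2.-integrable setT (EFin \o form_density s p u w).
  exact: (form_density_integrable p1 mD mu_ mw gu gw wD).
split => //; have [Ww cw] := test_function_Wsp0 annulus_open annulus_bounded tw.
case: wu => _ _ _ /(_ _ Ww w0 cw); rewrite frac_plap_formE//.
under [X in (_ + X)%E]eq_integral do rewrite -mulrA.
by rewrite integral_Q; under [X in (_ + X)%E]eq_integral do rewrite mulrA.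
Qed.

(** The equation of [u] is tested against [w] and against [w (./t)], whose
    support lies in [D] as [w] vanishes where [t x] is not in [D].  The change
    of variables by [t] turns the second identity into the weak equation of
    [u (t .)] tested against [w]; (A2) bounds its potential term from below. *)
Lemma form_scaled_diff w : test_function D w -> (forall x, ~ D (t *: x) -> w x = 0) ->
  [/\ mu2.-integrable setT (EFin \o (fun z =>
    form_density s p (fun x => u (t *: x)) w z - form_density s p u w z)),
  mu.-integrable setT
    (EFin \o (fun x => Q x * (J (u x) - J (u (t *: x))) * w x)) &
  (\int[mu2]_z (form_density s p (fun x => u (t *: x)) w z - form_density s p u w z)%:E
   <= \int[mu]_x (Q x * (J (u x) - J (u (t *: x))) * w x)%:E)%E].
Proof.
move=> tw wt; have [mw w0 [M wM] wD gw] := tw.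
have tV0 : 0 < t^-1 by rewrite invr_gt0.
have tw' : test_function D (fun x => w (t^-1 *: x)).
  split.
  - exact: measurableT_comp mw (@measurable_scale_rV R N _).
  - by move=> x; exact: w0.
  - by exists M => x; exact: wM.
  - by move=> x Dx; apply: wt; rewrite scalerA divff ?scale1r// gt_eqF.
  - exact: (gagliardo_scaled tV0 measurableT mw gw).
have [ib eb] := weak_eq tw.
have [i2 e2] := weak_eq tw'.
set F2 := form_density s p u (fun x => w (t^-1 *: x)) in i2 e2.
set Fa := form_density s p (fun x => u (t *: x)) w.
set Fb := form_density s p u w in ib eb *.
have i2d := integrable_dilation t0 i2.
have mut : measurable_fun setT (fun x : V => u (t *: x)).
  exact: measurableT_comp mu_ (@measurable_scale_rV R N t).
have FaE : Fa = (fun z => t `^ (N%:R + s * p) * F2 (dilation t z)).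
  by apply/funext => z; rewrite /Fa form_density_dilation.
have ia : mu2.-integrable setT (EFin \o Fa).
  rewrite FaE; have := integrableZl measurableT (t `^ (N%:R + s * p)) i2d.
  by apply: eq_integrable.
have iubw : mu.-integrable setT
    (EFin \o (fun x => Q x * (J (u x) - J (u (t *: x))) * w x)).
  have := integrableB measurableT (QJ_integrable mu_ u01 tw)
    (QJ_integrable mut (fun x => u01 (t *: x)) tw).
  by apply: eq_integrable => // x _ /=; rewrite -EFinB mulrBr mulrBl.
split=> //; first by have := integrableB measurableT ia ib; apply: eq_integrable.
(* The second potential term is rescaled so that it is an integral against [w]. *)
pose G x := Q (t *: x) * J (u (t *: x)) * w x.
have G0 x : 0 <= G x.
  rewrite /G; have /andP[] := J01 (u01 (t *: x)); move: (J _) => j j0 _.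
  by rewrite !mulr_ge0 ?Q0 ?w0.
have I2E : (\int[mu]_x (Q x * J (u x) * w (t^-1 *: x))%:E =
    (t ^+ N)%:E * \int[mu]_x (G x)%:E)%E.
  rewrite (@ge0_integral_scale _ _ t)//.
  - congr (_ * _)%E; apply: eq_integral => x _.
    by rewrite scalerA mulVf ?gt_eqF// scale1r.
  - by have /measurable_int := QJ_integrable mu_ u01 tw'.
  - move=> x; have /andP[] := J01 (u01 x); move: (J _) => j j0 _.
    by rewrite lee_fin !mulr_ge0 ?Q0 ?w0.
have iub := QJ_integrable mu_ u01 tw.
have iuw := QJ_integrable mut (fun x => u01 (t *: x)) tw.
have tn0 : 0 < t ^+ N by rewrite exprn_gt0.
have iG : mu.-integrable setT (EFin \o G).
  case: QM => K K0 QK; apply: (@bounded_support_integrable D _ (K * M)) => //.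
  - exact: annulus_open.
  - exact: annulus_bounded.
  - apply: measurable_funM => //; apply: measurable_funM => //.
      exact: measurableT_comp mQ (@measurable_scale_rV R N t).
    exact: measurableT_comp (@measurable_signed_pow _ p) mut.
  - move=> x; rewrite ger0_norm ?G0// /G.
    have /andP[] := J01 (u01 (t *: x)); move: (J (u (t *: x))) => j j0 j1.
    by rewrite ler_pM ?mulr_ge0 ?Q0 ?w0 ?wM// -[leRHS]mulr1 ler_pM ?Q0 ?QK.
  - by move=> x /wD; rewrite /G => ->; rewrite mulr0.
have real_of d (T : measurableType d) (m : {measure set T -> \bar R}) (f : T -> R) :
    m.-integrable setT (EFin \o f) -> exists r, (\int[m]_x (f x)%:E = r%:E)%E.
  move=> fi; exists (fine (\int[m]_x (f x)%:E)%E); rewrite fineK//.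
  exact: integrable_fin_num fi.
have [rb Eb] := real_of _ _ _ _ ib.
have [r2 E2] := real_of _ _ _ _ i2d.
have [rG EG] := real_of _ _ _ _ iG.
have [rub Eub] := real_of _ _ _ _ iub.
have [ruw Euw] := real_of _ _ _ _ iuw.
have Ea : (\int[mu2]_z (Fa z)%:E = (t `^ (N%:R + s * p) * r2)%:E)%E.
  rewrite FaE EFinM -E2.
  exact: (integralZl measurableT i2d (t `^ (N%:R + s * p))).
have eqb : rb + rub = 0.
  by move: eb; rewrite Eb Eub -EFinD; case.
have eq2 : t ^+ N * r2 + rG = 0.
  apply: (mulfI (lt0r_neq0 tn0)); rewrite mulr0 mulrDr mulrA.
  move: e2; rewrite (integral_dilation t0 i2) [X in (_ * X)%E]E2 I2E EG.
  by rewrite -!EFinM -EFinD; case.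
have potential : ruw <= t `^ (s * p) * rG.
  rewrite -lee_fin EFinM -EG -Euw -integralZl//; apply: le_integral => //.
    exact: integrableZl.
  move=> x _; rewrite -EFinM lee_fin /G.
  have /andP[J0 _] := J01 (u01 (t *: x)).
  have [Dx|/wD ->] := pselect (D x); last by rewrite !mulr0.
  have [Dtx|/wt ->] := pselect (D (t *: x)); last by rewrite !mulr0.
  move: (J (u (t *: x))) J0 => j j0.
  rewrite !mulrA ler_wpM2r// ler_wpM2r// /Q !patchE !mem_set//.
  exact: qt.
rewrite (integralB_EFin measurableT ia ib) Ea Eb.
rewrite (_ : (\int[mu]_x _)%E = (rub - ruw)%:E); last first.
  rewrite EFinB -Eub -Euw -integralB_EFin//.
  by apply: eq_integral => x _; rewrite -EFinB mulrBr mulrBl.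
rewrite -EFinB lee_fin (_ : t `^ _ = t `^ (s * p) * t ^+ N); last first.
  rewrite addrC powRD ?powR_mulrn ?(ltW t0)//.
  by rewrite gt_eqF// ltr_wpDr.
have -> : t `^ (s * p) * t ^+ N * r2 = - (t `^ (s * p) * rG).
  by rewrite -mulrA -mulrN; congr (_ * _); apply/eqP; rewrite -subr_eq0 opprK eq2.
have -> : rb = - rub by apply/eqP; rewrite -subr_eq0 opprK eqb.
by rewrite opprK (addrC _ rub); exact: lerB (lexx rub) potential.
Qed.

Let oD : open D. Proof. exact: annulus_open. Qed.

Variable zeta : V -> R.
Let ut (x : V) := u (t *: x).
Let U (x : V) := u (t *: x) + zeta x.
Let w (x : V) := Num.max (U x - u x) 0.
Hypotheses (mz : measurable_fun setT zeta) (z1 : forall x, zeta x <= 1).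
Hypothesis gz : (gagliardo s p [set x | D x /\ D (t *: x)] zeta < +oo)%E.
Hypothesis Uout : forall x, ~ (D x /\ D (t *: x)) -> U x <= u x.

Let mut : measurable_fun setT ut.
Proof. exact: measurableT_comp mu_ (@measurable_scale_rV R N t). Qed.

Let mw : measurable_fun setT w.
Proof.
apply: measurable_maxr => //; apply: measurable_funB => //.
exact: measurable_funD.
Qed.

Let w0 x : 0 <= w x. Proof. by rewrite le_max lexx orbT. Qed.

Let wout x : ~ (D x /\ D (t *: x)) -> w x = 0.
Proof. by move=> /Uout Ux; apply/max_idPr; rewrite subr_le0. Qed.

Let w2 x : w x <= 2.
Proof.
rewrite /w ge_max ler0n andbT /U.
have /andP[_ h1] := u01 (t *: x); have /andP[h2 _] := u01 x; have := z1 x; lra.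
Qed.

(** The increments of [w] are bounded by those of [u (t .)], [zeta] and [u],
    each of which has finite energy over [{x | D x /\ D (t *: x)}]. *)
Lemma pospart_test_function :
  test_function D w /\ (forall x, ~ D (t *: x) -> w x = 0).
Proof.
split; last by move=> x Dx; apply: wout => -[].
split; [exact: mw|exact: w0|by exists 2; exact: w2| |].
  by move=> x Dx; apply: wout => -[].
have mDt : measurable [set x : V | D (t *: x)].
  by rewrite -[X in measurable X]setTI; exact: measurable_scale_rV.
have mG : measurable [set x | D x /\ D (t *: x)] by exact: measurableI.
apply: (gagliardo_pospart p1 mG mut mz mu_ mw _ gz _ wout).
- apply: (gagliardo_subset mG mDt _ mut); first by move=> x [].
  exact: (gagliardo_scaled t0 mD mu_ gu).
- by apply: (gagliardo_subset mG mD _ mu_ gu) => x [].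
move=> x y; rewrite /w.
rewrite (le_trans (maxr0_dist _ _))// (_ : U x - u x - _ =
  ut x - ut y + (zeta x - zeta y - (u x - u y)))//.
by rewrite /U /ut; ring.
Qed.

Variables (eps h c k0 Cerr K b : R) (B Z : set V).
Hypotheses (eps0 : 0 <= eps) (c0 : 0 <= c) (k00 : 0 <= k0)
  (Cerr0 : 0 <= Cerr) (K0 : 0 <= K).
Hypothesis gap : forall a a' : R, `|a| <= 1 -> a + h <= a' -> c <= J a' - J a.
Hypotheses (mB : measurable B) (mZ : measurable Z).
Hypothesis BZ : forall x y, 0 < w x -> B x -> Z y ->
  [/\ U y <= u y, h <= (U x - u x) - (U y - u y) & k0 <= frac_kernel s p (x, y)].
Hypothesis rhs : forall x, D x -> q x * (J (u x) - J (ut x)) * w x <= eps * w x.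
Hypothesis err : forall x y, 0 < w x -> `|J (U x - U y) - J (ut x - ut y)| <=
  Cerr * Num.min (eucl_norm (x - y) `^ b) 1.
Hypothesis KP : forall x : V, (\int[mu]_y
    (Num.min (eucl_norm (x - y) `^ b) 1 /
     eucl_norm (x - y) `^ (N%:R + s * p))%:E <= K%:E)%E.

Let kap (z : V * V) : R := Num.min (eucl_norm (z.1 - z.2) `^ b) 1 * frac_kernel s p z.

Let kap0 z : 0 <= kap z.
Proof. by rewrite mulr_ge0 ?frac_kernel_ge0// le_min powR_ge0/=. Qed.

Let mkap : measurable_fun setT kap.
Proof.
apply: measurable_funM; last exact: measurable_frac_kernel.
apply: measurable_minr => //; apply: (measurableT_comp (measurable_powR _)).
by apply: measurable_eucl_dist; [exact: measurable_fst|exact: measurable_snd].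
Qed.

Let kap_swap z : kap (z.2, z.1) = kap z.
Proof. by rewrite /kap frac_kernel_swap/= eucl_distC. Qed.

(** The integrand with increments of [U] is nonnegative, and it is at least
    [c k0 w x] on [B x Z]; the replacement of the increments of [U] by those of
    [u (t .)] costs at most the last term, as it matters only where [w x] or
    [w y] is positive. *)
Let comparison_density_ge (x y : V) :
  c * k0 * (w x * \1_B x * \1_Z y) <=
  (form_density s p ut w (x, y) - form_density s p u w (x, y)) +
  Cerr * (w x + w y) * kap (x, y).
Proof.
pose Dx := U x - u x; pose Dy := U y - u y.
have UE : U x - U y = (u x - u y) + (Dx - Dy) by rewrite /Dx /Dy; ring.
have wx : w x = Num.max Dx 0 by [].
have wy : w y = Num.max Dy 0 by [].
have k_ge0 := frac_kernel_ge0 s p (x, y).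
rewrite /form_density /kap /incr/=.
move: (frac_kernel s p (x, y)) (@BZ x y) (@err x y) (@err y x) k_ge0 => k BZxy exy eyx k_ge0.
rewrite (eucl_distC y x) in eyx.
move: (Num.min (eucl_norm (x - y) `^ b) 1) exy eyx => m exy eyx.
have mono : 0 <= (J (U x - U y) - J (u x - u y)) * (w x - w y).
  have [xy|/ltW yx] := leP Dx Dy.
    rewrite mulr_le0// subr_le0; last by rewrite wx wy ge_max !le_max xy lexx !orbT.
    by rewrite signed_pow_le// UE gerDl subr_le0.
  rewrite mulr_ge0// subr_ge0; last by rewrite wx wy ge_max !le_max yx lexx !orbT.
  by rewrite signed_pow_le// UE lerDl subr_ge0.
have errb : (J (U x - U y) - J (ut x - ut y)) * (w x - w y) <= Cerr * m * (w x + w y).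
  rewrite (le_trans (ler_norm _))// normrM.
  have wxy : `|w x - w y| <= w x + w y.
    by rewrite (le_trans (ler_normB _ _))// !ger0_norm.
  have [wx0|] := ltP 0 (w x); first by rewrite ler_pM// exy.
  have [wy0 _|wy0 wx0] := ltP 0 (w y).
    rewrite ler_pM// (le_trans _ (eyx wy0))//.
    rewrite -[U x - U y]opprB -[ut x - ut y]opprB !signed_powN.
    by rewrite -opprD normrN.
  have -> : w x = 0 by apply/eqP; rewrite eq_le wx0 w0.
  have -> : w y = 0 by apply/eqP; rewrite eq_le wy0 w0.
  by rewrite subrr normr0 addr0 !mulr0.
have gain : c * k0 * (w x * \1_B x * \1_Z y) <=
    (J (U x - U y) - J (u x - u y)) * (w x - w y) * k.
  have rhs0 := mulr_ge0 mono k_ge0.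
  have [wx0|wx0] := ltP 0 (w x); last first.
    have wx00 : w x = 0 by apply/eqP; rewrite eq_le wx0 w0.
    by rewrite {1}wx00 !mul0r mulr0.
  have [Bx|nB] := pselect (B x); last by rewrite [\1_B x]indicE memNset// mulr0 mul0r mulr0.
  have [Zy|nZ] := pselect (Z y); last by rewrite [\1_Z y]indicE memNset// !mulr0.
  have [Uy hxy kk] := BZxy wx0 Bx Zy.
  rewrite !indicE !mem_set// !mulr1.
  have -> : w y = 0 by rewrite wy; apply/max_idPr; rewrite subr_le0.
  rewrite subr0 [leRHS]mulrAC.
  have ux1 : `|u x - u y| <= 1.
    by have := u01 x; have := u01 y; rewrite ler_norml => /andP[? ?] /andP[? ?]; lra.
  have hc : c <= J (U x - U y) - J (u x - u y) by rewrite gap// UE lerD2l.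
  by rewrite ler_wpM2r// ler_pM.
have -> : J (ut x - ut y) * (w x - w y) * k - J (u x - u y) * (w x - w y) * k =
   (J (U x - U y) - J (u x - u y)) * (w x - w y) * k -
   (J (U x - U y) - J (ut x - ut y)) * (w x - w y) * k by ring.
apply: (le_trans gain); rewrite -[leRHS]addrA lerDl addrC subr_ge0.
rewrite (_ : Cerr * _ * _ = Cerr * m * (w x + w y) * k); last by ring.
by rewrite ler_wpM2r.
Qed.

(** By symmetry of the truncated kernel both halves of the error term have
    the same integral, at most [Cerr * K] times the integral of [w]. *)
Lemma comparison_estimate :
  ((c * k0)%:E * (\int[mu]_x (w x * \1_B x)%:E * mu Z) <=
   (eps + 2 * Cerr * K)%:E * \int[mu]_x (w x)%:E)%E.
Proof.
have [tw wt] := pospart_test_function.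
have [iF iq Fq] := form_scaled_diff tw wt.
have iw : mu.-integrable setT (EFin \o w).
  apply: (@bounded_support_integrable D _ 2); [exact: oD| |exact: mw| |].
  - exact: annulus_bounded.
  - by move=> x; rewrite ger0_norm.
  - by move=> x Dx; apply: wout => -[].
have mEw : measurable_fun setT (fun x => (w x)%:E) by exact/measurable_EFinP.
pose psi z := w z.1 * kap z.
have psi0 z : 0 <= psi z by rewrite mulr_ge0.
have mpsi : measurable_fun setT psi.
  by apply: measurable_funM => //; exact: measurableT_comp mw measurable_fst.
have psiK : (\int[mu2]_z (psi z)%:E <= K%:E * \int[mu]_x (w x)%:E)%E.
  rewrite fubini_tonelli1//; last exact/measurable_EFinP.
  rewrite -ge0_integralZl_EFin//; last by move=> x _; rewrite lee_fin.
  apply: ge0_le_integral => //.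
  - by move=> x _; apply: integral_ge0 => y _; rewrite lee_fin.
  - by apply: (measurable_fun_fubini_tonelli_F (EFin \o psi)) => //; exact/measurable_EFinP.
  - exact: measurable_funeM.
  move=> x _; rewrite /fubini_F /psi/=.
  under eq_integral do rewrite EFinM.
  rewrite ge0_integralZl_EFin//; last 2 first.
  - by move=> y _; rewrite lee_fin.
  - by apply/measurable_EFinP; exact: (measurable_fun_pair2 _ mkap).
  by rewrite muleC lee_wpmul2r ?lee_fin//; exact: KP.
have ipsi : mu2.-integrable setT (EFin \o psi).
  apply/integrableP; split; first exact/measurable_EFinP.
  under eq_integral do rewrite /= ger0_norm//.
  apply: le_lt_trans psiK _; rewrite lte_mul_pinfty ?lee_fin//.
  exact: integrable_lty iw.
have ipsi' := integrable_swap ipsi.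
have psiK' : (\int[mu2]_z (psi (z.2, z.1))%:E <= K%:E * \int[mu]_x (w x)%:E)%E.
  by rewrite (ge0_integral_swap (f := EFin \o psi))//; exact/measurable_EFinP.
pose F z := form_density s p ut w z - form_density s p u w z.
pose L z := c * k0 * (w z.1 * \1_B z.1 * \1_Z z.2).
have L0 z : 0 <= L z by rewrite !mulr_ge0.
have mBw : measurable_fun setT (fun x => w x * \1_B x).
  by apply: measurable_funM => //; exact: measurable_indic.
have mL : measurable_fun setT L.
  apply: measurable_funM => //; apply: measurable_funM.
    exact: measurableT_comp mBw measurable_fst.
  by apply: (measurableT_comp _ measurable_snd); exact: measurable_indic.
have LE : (\int[mu2]_z (L z)%:E =
    (c * k0)%:E * (\int[mu]_x (w x * \1_B x)%:E * mu Z))%E.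
  rewrite fubini_tonelli1//; last exact/measurable_EFinP.
  rewrite -ge0_integralZr//; last 2 first.
  - exact/measurable_EFinP.
  - by move=> x _; rewrite lee_fin mulr_ge0.
  rewrite -ge0_integralZl_EFin ?mulr_ge0//; last 2 first.
  - by move=> x _; rewrite mule_ge0// lee_fin mulr_ge0.
  - by under eq_fun do rewrite muleC; apply: measurable_funeM; exact/measurable_EFinP.
  apply: eq_integral => x _; rewrite /fubini_F /L/=.
  under eq_integral do rewrite mulrA EFinM.
  rewrite ge0_integralZl_EFin//; last 2 first.
  - by apply/measurable_EFinP; exact: measurable_indic.
  - by rewrite !mulr_ge0.
  by rewrite integral_indic// setIT EFinM muleA.
have ia := integrableZl measurableT Cerr ipsi.
have ib := integrableZl measurableT Cerr ipsi'.
have iab := integrableD measurableT ia ib.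
have iR := integrableD measurableT iF iab.
have LR z : L z <= F z + (Cerr * psi z + Cerr * psi (z.2, z.1)).
  case: z => x y; have := comparison_density_ge x y.
  rewrite /L /F /psi/= (kap_swap (x, y)); set f1 := form_density _ _ ut _ _.
  set f2 := form_density _ _ u _ _ => /le_trans; apply; rewrite lerD2l.
  by rewrite -mulrA mulrDl mulrDr.
have iL : mu2.-integrable setT (EFin \o L).
  apply: le_integrable iR => //; first exact/measurable_EFinP.
  move=> z _ /=; rewrite lee_fin ger0_norm// ger0_norm ?LR//.
  exact: le_trans (LR z).
have LiR := le_integral measurableT iL iR (fun z _ => LR z).
rewrite -LE; apply: (le_trans LiR); clear LiR.
have sumE := etrans (integralD measurableT iF iab) (f_equal2 adde erefl
  (etrans (integralD measurableT ia ib) (f_equal2 adde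
    (integralZl measurableT ipsi Cerr) (integralZl measurableT ipsi' Cerr)))).
rewrite [leLHS]sumE.
have fw : (\int[mu]_x (w x)%:E)%E \is a fin_num by exact: integrable_fin_num iw.
rewrite EFinD muleDl//.
apply: leeD.
  apply: (le_trans Fq); rewrite -(integralZl measurableT iw).
  apply: (le_integral measurableT iq (integrableZl measurableT eps iw)) => x _ /=.
  rewrite lee_fin /Q patchE; case: ifPn => [/set_mem|_]; first exact: rhs.
  by rewrite !mul0r mulr_ge0.
rewrite (_ : 2 * Cerr * K = Cerr * K + Cerr * K); last by ring.
rewrite EFinD muleDl//.
have Cerr0' : (0 <= Cerr%:E)%E by rewrite lee_fin.
rewrite EFinM -muleA.
exact: (leeD (lee_wpmul2l Cerr0' psiK) (lee_wpmul2l Cerr0' psiK')).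
Qed.

End scaled_equation.

(** * Perturbation by a small tent *)

Section tent.
Context {R : realType} {n : nat}.
Implicit Types (x y : 'rV[R]_n) (r : R).

(** A Lipschitz bump suffices: only bounds on first increments enter the
    estimates, not second-order cancellation in the kernel. *)
Definition tent y0 r x : R := Num.max (1 - `|x - y0| / r) 0.

Variables (y0 : 'rV[R]_n) (r : R).
Hypothesis r0 : 0 < r.

Lemma tent_ge0 x : 0 <= tent y0 r x.
Proof. by rewrite le_max lexx orbT. Qed.

Lemma tent_le1 x : tent y0 r x <= 1.
Proof. by rewrite ge_max ler01 andbT gerBl divr_ge0// ltW. Qed.

Lemma tent_center : tent y0 r y0 = 1.
Proof. by rewrite /tent subrr normr0 mul0r subr0; apply/max_idPl. Qed.

Lemma tent_out x : r <= `|x - y0| -> tent y0 r x = 0.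
Proof. by move=> rx; apply/max_idPr; rewrite subr_le0 ler_pdivlMr// mul1r. Qed.

Lemma tent_dist1 x y : `|tent y0 r x - tent y0 r y| <= 1.
Proof.
have := tent_ge0 x; have := tent_ge0 y; have := tent_le1 x; have := tent_le1 y.
by move=> *; rewrite ler_norml; apply/andP; split; lra.
Qed.

Lemma tent_lipschitz x y : `|tent y0 r x - tent y0 r y| <= r^-1 * `|x - y|.
Proof.
rewrite (le_trans (maxr0_dist _ _))//.
rewrite (_ : _ - _ = (`|y - y0| - `|x - y0|) * r^-1); last by ring.
rewrite normrM (@ger0_norm _ r^-1) ?invr_ge0 ?(ltW r0)// mulrC.
rewrite ler_wpM2l ?invr_ge0 ?(ltW r0)// (le_trans (ler_dist_dist _ _))//.
by rewrite opprB addrA subrK distrC.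
Qed.

Lemma tent_eucl_lipschitz x y : `|tent y0 r x - tent y0 r y| <= r^-1 * eucl_norm (x - y).
Proof.
by rewrite (le_trans (tent_lipschitz _ _))// ler_wpM2l ?invr_ge0 ?(ltW r0)// le_norm_eucl.
Qed.

Lemma tent_continuous : continuous (tent y0 r).
Proof.
move=> x A /nbhs_ballP[e /= e0 eA]; apply/nbhs_ballP.
exists (e * r) => /=; first by rewrite mulr_gt0.
move=> y; rewrite -ball_normE /ball_/= => xy; apply: eA.
rewrite -ball_normE /ball_/= (le_lt_trans (tent_lipschitz _ _))//.
by rewrite mulrC ltr_pdivrMr.
Qed.

End tent.

Section perturbation.
Context {R : realType} {N : nat} (s p : R).
Local Notation V := 'rV[R]_N.
Local Notation J := (signed_pow p).
Implicit Types v : V -> R.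

(** Adding a tent of height [d] to [v] near [y0] changes the [p]-Laplacian
    density of [v] by an amount that is integrable against the kernel, because
    [s * p < b], and that tends to [0] with [d].  The radius [r] is chosen
    before [C] and the height [d] after it. *)
Definition small_perturbation v (y0 : V) := exists r1 b th : R,
  [/\ 0 < r1, s * p < b, 0 < th & forall r, 0 < r -> r <= r1 ->
   exists2 C, 0 <= C & forall d x y, 0 < d -> d <= 1 -> `|x - y0| < r ->
    `|J (v x - v y + d * (tent y0 r x - tent y0 r y)) - J (v x - v y)| <=
     C * d `^ th * Num.min (eucl_norm (x - y) `^ b) 1].

Lemma min_powR (e b : R) : 0 <= e -> 0 <= b -> Num.min e 1 `^ b <= Num.min (e `^ b) 1.
Proof.
move=> e0 b0; rewrite le_min; apply/andP; split.
  by rewrite ge0_ler_powR ?nnegrE ?le_min ?e0 ?ler01// ge_min lexx.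
have m1 : Num.min e 1 <= 1 by rewrite ge_min lexx orbT.
by rewrite (le_trans (ge0_ler_powR b0 _ _ m1)) ?nnegrE ?le_min ?e0 ?ler01// powR1.
Qed.

(** [J] is Hoelder continuous of exponent [p - 1], so no regularity of [v] is
    involved. *)
Lemma small_perturbation_sub v (y0 : V) : s < 1 -> (1 - s)^-1 < p -> 1 < p -> p <= 2 ->
  small_perturbation v y0.
Proof.
move=> s1 sp p1 p2; have b0 : 0 < p - 1 by rewrite subr_gt0.
exists 1, (p - 1), (p - 1); split => //.
  have : 1 < p * (1 - s) by rewrite -ltr_pdivrMr ?subr_gt0// mul1r.
  lra.
move=> r r0 _; pose L := r^-1 + 1; have L0 : 0 <= L by rewrite addr_ge0// invr_ge0 ltW.
exists (2 * L `^ (p - 1)) => [|d x y d0 d1 xr]; first by rewrite mulr_ge0 ?powR_ge0.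
have p12 : 1 < p <= 2 by rewrite p1.
rewrite (le_trans (signed_pow_hoelder p12 _ _))// addrAC subrr add0r.
set e := eucl_norm (x - y); have e0 : 0 <= e by exact: eucl_norm_ge0.
rewrite -!mulrA ler_pM2l// normrM powRM// (gtr0_norm d0) mulrCA ler_wpM2l ?powR_ge0//.
rewrite (le_trans _ (ler_wpM2l (powR_ge0 _ _) (min_powR e0 (ltW b0))))//.
rewrite -powRM ?le_min ?e0 ?ler01//.
have m0 : 0 <= Num.min e 1 by rewrite le_min e0 ler01.
rewrite ge0_ler_powR ?nnegrE ?(ltW b0) ?mulr_ge0//.
rewrite minr_pMr// le_min mulr1; apply/andP; split.
  rewrite (le_trans (tent_eucl_lipschitz _ _ _ _))// ler_wpM2r// lerDl//.
by rewrite (le_trans (tent_dist1 _ _ _ _))// lerDr invr_ge0 ltW.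
Qed.

(** Near the diagonal [|J (a + h) - J a|] is of order [|a|^(p-2) |h|] with
    [|a|] of order [|x - y|^alpha] and [|h|] of order [d |x - y|]; away from
    it, all increments are bounded and [|h| <= d]. *)
Lemma small_perturbation_super u (t : R) (y0 : V) (D : set V) (alpha : R) :
  0 < t -> open D -> D (t *: y0) -> 2 <= p -> (forall x, 0 <= u x <= 1) ->
  0 < alpha -> alpha <= 1 -> holder_loc alpha D u -> s * p - 1 < alpha * (p - 2) ->
  small_perturbation (fun x : V => u (t *: x)) y0.
Proof.
move=> t0 oD Dy0 p2 u01 a0 a1 hu sa.
have [CJ CJ0 JP] := @signed_pow_lipschitz R p p2.
have p20 : 0 <= p - 2 by rewrite subr_ge0.
have /nbhs_ballP[e' /= e'0 e'D] : nbhs (t *: y0) D by exact: open_nbhs_nbhs.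
pose rho := e' / 2; have rho0 : 0 < rho by rewrite divr_gt0.
pose Kc : set V := @closed_ball_ R V Num.Def.normr (t *: y0) rho.
have rhoD : Kc `<=` D.
  move=> z; rewrite /Kc /closed_ball_/= => zK; apply: e'D.
  by rewrite -ball_normE /ball_/= (le_lt_trans zK)// ltr_pdivrMr// ltr_pMr// ltr1n.
have cK : compact Kc.
  apply: bounded_closed_compact; last exact: closed_closed_ball_.
  exists (`|t *: y0| + rho); split; first exact: num_real.
  move=> M MK z; rewrite /Kc /closed_ball_/= => zK.
  rewrite (le_trans _ (ltW MK))// -(subrK (t *: y0) z) (le_trans (ler_normD _ _))//.
  by rewrite addrC lerD2l distrC.
have [CH0 hH] := hu _ cK rhoD; pose CH := `|CH0|.
(* If [|x - y0| < r] and [|x - y| < r] then [t x] and [t y] are in [Kc]. *)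
pose r1 := Num.min 1 (rho / (2 * t)).
have b0 : 0 <= alpha * (p - 2) by rewrite mulr_ge0// ltW.
have b10 : 0 <= alpha * (p - 2) + 1 by rewrite addr_ge0.
exists r1, (alpha * (p - 2) + 1), 1; split => //.
- by rewrite lt_min ltr01 divr_gt0// mulr_gt0.
- lra.
move=> r r0; rewrite le_min => /andP[rle1 rrho].
pose Q := 2 * (CH * t `^ alpha) + r^-1.
have Q0 : 0 <= Q by rewrite addr_ge0 ?mulr_ge0 ?powR_ge0 ?invr_ge0 ?(ltW r0)// normr_ge0.
pose C1 := CJ * Q `^ (p - 2) * r^-1.
pose C2 := CJ * 3 `^ (p - 2) / r `^ (alpha * (p - 2) + 1).
have C10 : 0 <= C1 by rewrite !mulr_ge0 ?powR_ge0 ?invr_ge0 ?(ltW r0) ?(ltW CJ0).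
have C20 : 0 <= C2 by rewrite !mulr_ge0 ?powR_ge0 ?invr_ge0 ?powR_ge0 ?(ltW CJ0).
exists (C1 + C2) => [|d x y d0 d1 xr]; first by rewrite addr_ge0.
rewrite powRr1 ?(ltW d0)//.
have [<-|xy] := eqVneq x y.
  rewrite !subrr mulr0 addr0 subrr normr0 !mulr_ge0 ?addr_ge0 ?(ltW d0)//.
  by rewrite le_min powR_ge0/=.
set e := eucl_norm (x - y).
have e0 : 0 < e by rewrite eucl_norm_gt0// subr_eq0.
set a := u (t *: x) - u (t *: y); set h := d * _.
have a_le1 : `|a| <= 1.
  have := u01 (t *: x); have := u01 (t *: y); rewrite ler_norml.
  by move=> /andP[? ?] /andP[? ?]; rewrite /a; lra.
have h_led : `|h| <= d.
  by rewrite normrM (gtr0_norm d0) ler_piMr ?(ltW d0)// tent_dist1.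
have h_le : `|h| <= d * (r^-1 * e).
  by rewrite normrM (gtr0_norm d0) ler_wpM2l ?(ltW d0)// tent_eucl_lipschitz.
have step (S : R) : 2 * `|a| + `|h| <= S ->
    `|J (a + h) - J a| <= CJ * S `^ (p - 2) * `|h|.
  move=> aS; have S0 : 0 <= S by rewrite (le_trans _ aS)// addr_ge0 ?mulr_ge0.
  rewrite (le_trans (JP _ _))// (addrC a) addrK ler_wpM2r//.
  rewrite ler_wpM2l ?(ltW CJ0)// ge0_ler_powR ?nnegrE ?p20 ?addr_ge0//.
  rewrite (le_trans _ aS)// (le_trans (lerD (ler_normD _ _) (lexx _)))//.
  by rewrite mulr_natl mulr2n -addrA addrC.
have [er|re] := ltP e r.
  have e1 : e <= 1 by rewrite (le_trans (ltW er)).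
  have ea : e <= e `^ alpha by rewrite ger1_powR// e0.
  have ball_in (z : V) : `|z - y0| < 2 * r -> Kc (t *: z).
    move=> zr; rewrite /Kc /closed_ball_/= -scalerBr normrZ (gtr0_norm t0) distrC.
    rewrite -ler_pdivlMl// (le_trans (ltW zr))// -ler_pdivlMl//.
    by rewrite (le_trans rrho)// invfM mulrA (mulrC rho) mulrAC.
  have aH : `|a| <= CH * t `^ alpha * e `^ alpha.
    have Kx : Kc (t *: x) by apply: ball_in; rewrite (lt_trans xr)// ltr_pMl// ltr1n.
    have Ky : Kc (t *: y).
      apply: ball_in; rewrite -(subrK x y) -addrA (le_lt_trans (ler_normD _ _))//.
      rewrite mulr_natl mulr2n ltrD//.
      by rewrite distrC (le_lt_trans (le_norm_eucl _)).
    apply: (le_trans (hH _ _ Kx Ky)).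
    rewrite -scalerBr (eucl_normZ _ (ltW t0)).
    rewrite powRM ?(ltW t0) ?(ltW e0)// mulrA ler_wpM2r ?powR_ge0//.
    by rewrite ler_wpM2r ?powR_ge0// ler_norm.
  have S1 : 2 * `|a| + `|h| <= Q * e `^ alpha.
    rewrite [leRHS]mulrDl lerD//; first by rewrite -mulrA ler_pM2l.
    rewrite (le_trans h_le)// (@le_trans _ _ (1 * (r^-1 * e)))//.
      by rewrite ler_wpM2r// mulr_ge0 ?invr_ge0 ?(ltW r0) ?(ltW e0).
    by rewrite mul1r ler_wpM2l// invr_ge0 ltW.
  rewrite (le_trans (step _ S1))//.
  have -> : Num.min (e `^ (alpha * (p - 2) + 1)) 1 = e `^ (alpha * (p - 2) + 1).
    have e01 : 0 < e <= 1 by rewrite e0.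
    by apply/min_idPl; have := ger_powR e01 b10; rewrite powRr0.
  have -> : e `^ (alpha * (p - 2) + 1) = e `^ (alpha * (p - 2)) * e.
    rewrite powRD ?powRr1 ?(ltW e0)//.
    by apply/implyP => _; rewrite gt_eqF.
  rewrite powRM ?powR_ge0// -powRrM.
  set E := e `^ _; have E0 : 0 <= E by exact: powR_ge0.
  apply: (@le_trans _ _ (C1 * d * (E * e))); last first.
    rewrite ler_wpM2r ?mulr_ge0 ?(ltW e0)// ler_wpM2r ?(ltW d0)//.
    by rewrite lerDl.
  rewrite (_ : C1 * d * (E * e) = CJ * (Q `^ (p - 2) * E) * (d * (r^-1 * e))); last first.
    by rewrite /C1; ring.
  by rewrite ler_wpM2l// !mulr_ge0 ?powR_ge0 ?(ltW CJ0).
have S2 : 2 * `|a| + `|h| <= 3 by have := le_trans h_led d1; move: a_le1; lra.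
rewrite (le_trans (step _ S2))//.
apply: (@le_trans _ _ (C2 * d * r `^ (alpha * (p - 2) + 1))).
  rewrite /C2 (mulrAC _ d) divfK; last by rewrite gt_eqF// powR_gt0.
  by rewrite ler_wpM2l// mulr_ge0 ?powR_ge0 ?(ltW CJ0).
apply: (ler_pM (mulr_ge0 C20 (ltW d0)) (powR_ge0 _ _)).
  by apply: ler_wpM2r; rewrite ?(ltW d0)// lerDr.
rewrite le_min; apply/andP; split.
  by rewrite ge0_ler_powR ?nnegrE ?(ltW r0) ?(ltW e0).
have r01 : 0 < r <= 1 by rewrite r0.
by have := ger_powR r01 b10; rewrite powRr0.
Qed.

End perturbation.

(** * Comparison of a solution with its rescalings *)

Section starshaped_sets.
Context {R : realType} {N : nat}.

Lemma starshaped_scale_inv (A : set 'rV[R]_N) (t : R) x : starshaped A -> 1 <= t ->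
  A (t *: x) -> A x.
Proof.
move=> [_ sA] t1 Atx; have t0 : 0 < t by rewrite (lt_le_trans _ t1).
apply: (sA t^-1); first by rewrite invr_ge0 (ltW t0) invf_le1.
by exists (t *: x) => //; rewrite scalerA mulVf ?gt_eqF// scale1r.
Qed.

Lemma starshaped_closure (A : set 'rV[R]_N) : starshaped A -> starshaped (closure A).
Proof.
move=> [A0 sA]; split; first exact: subset_closure.
move=> t t01 _ [x Ax <-] B Btx.
have cs : continuous (fun y : 'rV[R]_N => t *: y) by exact: scaler_continuous.
have /Ax [z [Az Bz]] := cs x B Btx.
by exists (t *: z); split => //; apply: (sA t t01); exists z.
Qed.

End starshaped_sets.

Section scaled_comparison.
Context {R : realType} {N : nat} (s p : R).
Hypotheses (N1 : (1 <= N)%N) (s01 : 0 < s < 1) (p1 : 1 < p).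
Local Notation mu := (@lebesgue_rV R N).
Local Notation V := 'rV[R]_N.
Local Notation J := (signed_pow p).
Variables (D0 D1 : set V) (q u : V -> R).
Local Notation D := (D0 `\` closure D1).
Hypotheses (oD0 : open D0) (bD0 : bounded_set D0).
Hypotheses (q0 : forall x, D x -> 0 <= q x) (mq : measurable_fun D q)
  (bq : [bounded q x | x in D]).
Hypotheses (cu : continuous u) (u01 : forall x, 0 <= u x <= 1)
  (wu : weak_solution s p D0 D1 q u).
Hypothesis qA2 : forall (t : R) (x : V), 1 <= t -> D x -> D (t *: x) ->
     q x <= t `^ (s * p) * q (t *: x).
Hypotheses (sD0 : starshaped D0) (sD1 : starshaped D1).

Let sp0 : 0 < s * p.
Proof. by case/andP: s01 => s0 _; rewrite mulr_gt0// (lt_trans _ p1). Qed.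

Let spp : s * p < p.
Proof. by case/andP: s01 => _ s1; rewrite gtr_pMl// (lt_trans _ p1). Qed.

Lemma solution0 x : ~ D0 x -> u x = 0.
Proof. by case: wu => _ h _ _; exact: h. Qed.

Lemma solution1 x : closure D1 x -> u x = 1.
Proof.
have cl1 : closed [set x | u x = 1].
  rewrite (_ : [set _ | _] = u @^-1` [set 1]) //.
  by apply: preimage_closed; [move=> y _; exact: cu|exact: closed_eq].
by move: x; rewrite closureE; apply: smallest_sub => // x; case: wu => _ _ h _; exact: h.
Qed.

(** Since [D0] is starshaped, [u (t x) = 0] if [x] or [t x] is outside [D0];
    since [closure D1] is, [u x = 1] if [x] or [t x] is in [closure D1]. *)
Lemma scaled_le_outside (t : R) x : 1 <= t -> ~ (D x /\ D (t *: x)) -> u (t *: x) <= u x.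
Proof.
move=> t1 nG; have /andP[ux0 _] := u01 x; have /andP[_ utx1] := u01 (t *: x).
have [D0x|nD0x] := pselect (D0 x); last first.
  rewrite (@solution0 (t *: x))// => D0tx; apply: nD0x.
  exact: starshaped_scale_inv sD0 t1 D0tx.
have [D1x|nD1x] := pselect (closure D1 x); first by rewrite (solution1 D1x).
have [D0tx|nD0tx] := pselect (D0 (t *: x)); last by rewrite solution0.
have [D1tx|nD1tx] := pselect (closure D1 (t *: x)); last by case: nG.
by case: nD1x; exact: starshaped_scale_inv (starshaped_closure sD1) t1 D1tx.
Qed.

Lemma frac_kernel_ge (x y : V) (r : R) : x != y -> `|x - y| <= r ->
  ((N%:R * r) `^ (N%:R + s * p))^-1 <= frac_kernel s p (x, y).
Proof.
move=> xy xyr; have e0 : 0 < eucl_norm (x - y) by rewrite eucl_norm_gt0// subr_eq0.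
have er : eucl_norm (x - y) <= N%:R * r.
  by rewrite (le_trans (le_eucl_norm _))// ler_wpM2l.
have Nr0 : 0 < N%:R * r := lt_le_trans e0 er.
have c0 : 0 <= N%:R + s * p by rewrite addr_ge0// ltW.
rewrite /frac_kernel/= lef_pV2 ?posrE ?powR_gt0//.
by rewrite ge0_ler_powR ?nnegrE ?(ltW e0) ?(ltW Nr0).
Qed.

Lemma frac_kernel_lower_gt0 (r : R) : 0 < r -> 0 < ((N%:R * r) `^ (N%:R + s * p))^-1.
Proof. by move=> r0; rewrite invr_gt0 powR_gt0// mulr_gt0// ltr0n. Qed.

Let oD : open D. Proof. exact: annulus_open. Qed.

Lemma interior_annulus_measurable (t : R) : measurable [set x : V | D x /\ D (t *: x)].
Proof.
apply: measurableI; first exact: open_measurable_rV.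
rewrite -[X in measurable X]setTI; apply: measurable_scale_rV => //.
exact: open_measurable_rV.
Qed.

Lemma interior_annulus_lty (t : R) : (mu [set x : V | D x /\ D (t *: x)] < +oo)%E.
Proof.
apply: lebesgue_bounded_lty; first exact: interior_annulus_measurable.
case: bD0 => M [Mr MD0]; exists M; split => // K MK x [[D0x _] _].
exact: MD0 D0x.
Qed.

Lemma continuous_scaled (t : R) : continuous (fun x : V => u (t *: x)).
Proof.
move=> y; apply: (@continuous_comp _ _ _ (fun x : V => t *: x) u); last exact: cu.
exact: scaler_continuous.
Qed.

Let D0_bound : exists2 M : R, 0 < M & forall y, D0 y -> `|y| <= M.
Proof.
case: bD0 => M [Mr /(_ (`|M| + 1))]; rewrite ltr_pwDr ?ler_norm// => /(_ isT) MD0.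
by exists (`|M| + 1) => //; rewrite ltr_wpDl.
Qed.

Let q_bound : exists2 M : R, 0 < M & forall y, D y -> q y <= M.
Proof.
case: bq => M [_ /(_ (`|M| + 1))]; rewrite ltr_pwDr ?ler_norm// => /(_ isT) qM.
exists (`|M| + 1) => [|y Dy]; first by rewrite ltr_wpDl.
exact: le_trans (ler_norm _) (qM _ Dy).
Qed.

(** Apply the comparison estimate with [zeta = 0]: where [w > 0] the potential
    term has the good sign, and there is no error term. *)
Lemma scaled_le (t : R) (x : V) : 1 <= t -> u (t *: x) <= u x.
Proof.
move=> t1; have t0 : 0 < t by rewrite (lt_le_trans _ t1).
rewrite leNgt; apply/negP => ux.
pose kap := (u (t *: x) - u x) / 2.
have kap0 : 0 < kap by rewrite divr_gt0// subr_gt0.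
have cut := @continuous_scaled t.
have [r /= r0 Br] : exists2 r : R, 0 < r & ball x r `<=` [set y : V | kap < u (t *: y) - u y].
  have cd : {for x, continuous (fun y : V => u (t *: y) - u y)}.
    exact: (cvgB (@cut x) (@cu x)).
  have : \forall y \near (x : V), kap < u (t *: y) - u y.
    apply: (cvgr_gt _ cd).
    by rewrite /kap ltr_pdivrMr// ltr_pMr ?subr_gt0// ltr1n.
  by move=> /nbhs_ballP[r r0 rB]; exists r.
(* [N >= 1] is needed for points far away from [D0] to exist. *)
have [M M0 MD0] := D0_bound.
pose z0 : V := const_mx (M + 1).
have zM y : ball z0 1 y -> M < `|y|.
  rewrite -ball_normE /ball_/= => z0y.
  pose i := Ordinal N1.
  have := le_lt_trans (norm_coord (z0 - y) i) z0y.
  rewrite !mxE ltr_norml => /andP[_ yi].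
  by rewrite (lt_le_trans _ (norm_coord y i))// (lt_le_trans _ (ler_norm _))//; lra.
have Zout y : ball z0 1 y -> u y = 0 /\ u (t *: y) = 0.
  move=> /zM My; have nD0y : ~ D0 y by move=> /MD0; rewrite leNgt My.
  split; rewrite solution0// => D0ty; apply: nD0y.
  exact: starshaped_scale_inv sD0 t1 D0ty.
have [c c0 gap] := signed_pow_gap p1 kap0 ler01.
have [K K0 KP] := integral_trunc_kernel N sp0 spp.
pose rho := M + (`|z0| + 1).
have rho0 : 0 < rho by rewrite addr_gt0// ltr_wpDl.
have k00 := frac_kernel_lower_gt0 rho0.
have mball (a : V) (e : R) : measurable (ball a e).
  by apply: open_measurable_rV; exact: ball_open.
have gz : (gagliardo s p [set x : V | D x /\ D (t *: x)] (cst 0%R : V -> R) < +oo)%E.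
  apply: (@gagliardo_lipschitz _ _ s p sp0 p1 _ (cst 0) 0 spp) => //.
  - exact: interior_annulus_measurable.
  - exact: interior_annulus_lty.
  - by move=> y z; rewrite subrr normr0.
  - by move=> y z; rewrite subrr normr0 mul0r.
have Uout y : ~ (D y /\ D (t *: y)) -> u (t *: y) + cst 0 y <= u y.
  by rewrite /= addr0; exact: scaled_le_outside.
have est := comparison_estimate sp0 p1 oD0 bD0 q0 mq bq cu u01 wu t0
  (fun x => @qA2 t x t1) (measurable_cst _) (fun _ => ler01) gz Uout
  (lexx 0) (ltW c0) (ltW k00) (lexx 0) K0
  gap (mball x r) (mball z0 1) _ _ _ KP.
pose w (y : V) := Num.max (u (t *: y) + cst 0 y - u y) 0.
have wB y : ball x r y -> kap < w y.
  by move=> /Br /= yB; rewrite lt_max addr0 yB.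
have mw : measurable_fun setT w.
  apply: measurable_maxr => //; apply: measurable_funB; last exact: continuous_measurable_rV.
  by apply: measurable_funD => //; exact: continuous_measurable_rV.
have muZ0 : (0 < mu (ball z0 1))%E by exact: lebesgue_ball_gt0.
suff : ((c * ((N%:R * rho) `^ (N%:R + s * p))^-1)%:E *
    (\int[mu]_y (w y * \1_(ball x r) y)%:E * mu (ball z0 1)) <= 0)%E.
  apply/negP; rewrite -ltNge mule_gt0//; first by rewrite lte_fin mulr_gt0.
  rewrite mule_gt0//.
  apply: (@lt_le_trans _ _ (\int[mu]_y (kap%:E * (\1_(ball x r) y)%:E))%E).
    rewrite ge0_integralZl_EFin ?(ltW kap0)//; last first.
      by apply/measurable_EFinP; exact: measurable_indic.
    by rewrite integral_indic// setIT mule_gt0 ?lte_fin// lebesgue_ball_gt0.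
  apply: ge0_le_integral => //.
  - by move=> y _; rewrite mule_ge0 ?lee_fin// ltW.
  - by apply: measurable_funeM; apply/measurable_EFinP; exact: measurable_indic.
  - by apply/measurable_EFinP; apply: measurable_funM => //; exact: measurable_indic.
  move=> y _; rewrite -EFinM lee_fin indicE.
  have [yB|nyB] := pselect (ball x r y); last by rewrite memNset// !mulr0.
  by rewrite mem_set// !mulr1 ltW// wB.
rewrite -[X in (_ <= X)%E](mul0e (\int[mu]_y (w y)%:E)).
rewrite (_ : 0%E = (0 + 2 * 0 * K)%:E); last by rewrite mulr0 mul0r addr0.
apply: est.
- move=> y z wy yB zB; have [uz utz] := Zout _ zB.
  have hy := Br _ yB; rewrite /= in hy.
  rewrite /= !addr0 uz utz subrr subr0; split => //; first exact: ltW.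
  have yz : y != z.
    by apply: contraTneq hy => ->; rewrite uz utz subrr -leNgt ltW.
  apply: frac_kernel_ge => //.
  have D0y : `|y| <= M.
    apply: MD0; apply: contrapT => nD0y.
    have : u (t *: y) <= u y by apply: scaled_le_outside => // -[[]].
    by rewrite leNgt -subr_gt0 (lt_trans kap0).
  rewrite (le_trans (ler_normB _ _))// lerD//.
  move: zB; rewrite -ball_normE /ball_/= => zB.
  rewrite -(subrK z0 z) (le_trans (ler_normD _ _))// addrC lerD2l distrC.
  exact: ltW.
- move=> y Dy; rewrite mul0r /= addr0.
  have [uy|uy] := leP (u (t *: y)) (u y).
    by rewrite (_ : Num.max _ _ = 0) ?mulr0//; apply/max_idPr; rewrite subr_le0.
  rewrite mulr_le0_ge0// ?le_max ?lexx ?orbT//.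
  by rewrite mulr_ge0_le0 ?q0// subr_le0 signed_pow_le// ltW.
- by move=> y z _; rewrite /= !addr0 subrr normr0 mul0r.
Qed.

(** The constants are chosen in this order: the gain [c * k0 * m] from a ball
    [Z] around [z0], independent of the tent as long as its height is at most
    [c1 / 2]; then the radius [r], so that the potential term is at most a
    quarter of the gain; then the height [d], so that the error is also at most
    a quarter of it. *)
Lemma no_touching (t : R) (y0 z0 : V) : 1 <= t -> D y0 -> D (t *: y0) ->
  u (t *: y0) = u y0 -> u (t *: z0) < u z0 ->
  ~ small_perturbation s p (fun x : V => u (t *: x)) y0.
Proof.
move=> t1 Dy0 Dty0 uy0 uz0 [r1 [b [th [r10 bsp th0 pert]]]].
have t0 : 0 < t by rewrite (lt_le_trans _ t1).
have cut := @continuous_scaled t.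
pose c1 := (u z0 - u (t *: z0)) / 2.
have c10 : 0 < c1 by rewrite divr_gt0// subr_gt0.
have [rho /= rho0 Zc1] : exists2 rho : R, 0 < rho &
    ball z0 rho `<=` [set y : V | c1 < u y - u (t *: y)].
  have cd : {for z0, continuous (fun y : V => u y - u (t *: y))}.
    exact: (cvgB (@cu z0) (@cut z0)).
  have : \forall y \near (z0 : V), c1 < u y - u (t *: y).
    apply: (cvgr_gt _ cd).
    by rewrite /c1 ltr_pdivrMr// ltr_pMr ?subr_gt0// ltr1n.
  by move=> /nbhs_ballP[rho rho0 rhoB]; exists rho.
have c120 : 0 < c1 / 2 by rewrite divr_gt0.
have [c c0 gap] := signed_pow_gap p1 c120 ler01.
have [K K0 KP] := integral_trunc_kernel N sp0 bsp.
have [M M0 MD0] := D0_bound.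
pose L := M + (`|z0| + rho).
have L0 : 0 < L by rewrite addr_gt0// ltr_wpDl.
have k00 := frac_kernel_lower_gt0 L0.
set k0 := ((N%:R * L) `^ (N%:R + s * p))^-1 in k00.
have mball (a : V) (e : R) : measurable (ball a e).
  by apply: open_measurable_rV; exact: ball_open.
pose Z : set V := ball z0 rho.
have muZ0 : (0 < mu Z)%E by exact: lebesgue_ball_gt0.
have muZoo : (mu Z < +oo)%E.
  apply: lebesgue_bounded_lty; first exact: mball.
  exists (`|z0| + rho); split; first exact: num_real.
  move=> A AM y; rewrite /Z -ball_normE /ball_/= => yZ.
  rewrite (le_trans _ (ltW AM))// -(subrK z0 y) (le_trans (ler_normD _ _))//.
  by rewrite addrC lerD2l distrC ltW.
have muZE : mu Z = (fine (mu Z))%:E by rewrite fineK// ge0_fin_numE// ltW.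
pose m := fine (mu Z).
have m0 : 0 < m by rewrite -lte_fin -muZE.
pose eps := c * k0 * m / 4.
have eps0 : 0 < eps by rewrite divr_gt0// !mulr_gt0.
have [Mq Mq0 qM] := q_bound.
have [r2 /= r20 r2B] : exists2 r2 : R, 0 < r2 & ball y0 r2 `<=`
    [set y : V | [/\ D y, D (t *: y) & J (u y) - J (u (t *: y)) < eps / Mq]].
  have n1 : nbhs (y0 : V) D by exact: open_nbhs_nbhs.
  have n2 : nbhs (y0 : V) [set y : V | D (t *: y)].
    have oDt : open [set y : V | D (t *: y)].
      by apply: (open_comp (f := fun y : V => t *: y)) => // y _; exact: scaler_continuous.
    exact: open_nbhs_nbhs.
  have n4 : \forall y \near (y0 : V), J (u y) - J (u (t *: y)) < eps / Mq.
    have cJ1 := continuous_comp (@cu y0) (@continuous_signed_pow R p p1 (u y0)).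
    have cJ2 := continuous_comp (@cut y0) (@continuous_signed_pow R p p1 (u (t *: y0))).
    apply: (cvgr_lt _ (cvgB cJ1 cJ2)).
    by rewrite /= uy0 subrr divr_gt0.
  have n5 : \forall y \near (y0 : V),
      [/\ D y, D (t *: y) & J (u y) - J (u (t *: y)) < eps / Mq].
    by apply: filterS3 n1 n2 n4 => y.
  by move: n5 => /nbhs_ballP[r2 r20 r2B]; exists r2.
pose r := Num.min r1 r2.
have r0 : 0 < r by rewrite lt_min r10.
have rB (y : V) : `|y - y0| < r ->
    [/\ D y, D (t *: y) & J (u y) - J (u (t *: y)) < eps / Mq].
  move=> yr; apply: r2B; rewrite -ball_normE /ball_/= distrC (lt_le_trans yr)//.
  by rewrite ge_min lexx orbT.
have [C C0 errC] : exists2 C, 0 <= C & forall d (x y : V), 0 < d -> d <= 1 ->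
    `|x - y0| < r ->
    `|J (u (t *: x) - u (t *: y) + d * (tent y0 r x - tent y0 r y)) -
      J (u (t *: x) - u (t *: y))| <=
     C * d `^ th * Num.min (eucl_norm (x - y) `^ b) 1.
  by apply: pert => //; rewrite ge_min lexx.
pose e' := eps / (2 * (C * K) + 1).
have CK0 : 0 < 2 * (C * K) + 1 by rewrite ltr_wpDl// !mulr_ge0.
have e'0 : 0 < e' by rewrite divr_gt0.
pose d := Num.min (Num.min 1 (c1 / 2)) (e' `^ th^-1).
have d0 : 0 < d by rewrite !lt_min ltr01 c120 powR_gt0.
have d1 : d <= 1 by rewrite !ge_min lexx.
have dc : d <= c1 / 2 by rewrite !ge_min lexx orbT.
have dth : d `^ th <= e'.
  apply: (@le_trans _ _ ((e' `^ th^-1) `^ th)).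
    by rewrite ge0_ler_powR ?nnegrE ?powR_ge0 ?(ltW th0) ?(ltW d0)// ge_min lexx orbT.
  by rewrite -powRrM mulVf ?gt_eqF// powRr1// ltW.
pose zeta (x : V) := d * tent y0 r x.
have zeta_le x : zeta x <= d by rewrite ler_piMr ?(ltW d0)// tent_le1.
have zeta_out (x : V) : r <= `|x - y0| -> zeta x = 0.
  by move=> xr; rewrite /zeta tent_out// mulr0.
have mzeta : measurable_fun setT zeta.
  apply: measurable_funM => //; apply: continuous_measurable_rV.
  exact: tent_continuous.
pose w (x : V) := Num.max (u (t *: x) + zeta x - u x) 0.
have ut_le x : u (t *: x) <= u x by exact: scaled_le.
have w_supp x : 0 < w x -> `|x - y0| < r.
  rewrite /w lt_max ltxx orbF subr_gt0 ltNge => wx; rewrite ltNge.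
  by apply: contra wx => xr; rewrite zeta_out// addr0.
have gz : (gagliardo s p [set x : V | D x /\ D (t *: x)] zeta < +oo)%E.
  apply: (@gagliardo_lipschitz _ _ s p sp0 p1 _ zeta r^-1 spp).
  - exact: interior_annulus_measurable.
  - exact: interior_annulus_lty.
  - exact: mzeta.
  - by rewrite invr_ge0 ltW.
  - move=> x y; rewrite /zeta -mulrBr normrM (gtr0_norm d0).
    by rewrite mulr_ile1 ?(ltW d0)// tent_dist1.
  - move=> x y; rewrite /zeta -mulrBr normrM (gtr0_norm d0).
    by rewrite -[leRHS]mul1r ler_pM ?(ltW d0)// tent_eucl_lipschitz.
have Uout x : ~ (D x /\ D (t *: x)) -> u (t *: x) + zeta x <= u x.
  move=> nG; rewrite zeta_out ?addr0// leNgt; apply/negP => /rB[? ? _].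
  exact: nG.
have zeta1 x : zeta x <= 1 by exact: le_trans (zeta_le x) d1.
have [[mw w0 _ wD _] _] :=
  pospart_test_function p1 oD0 cu u01 wu t0 mzeta zeta1 gz Uout.
have est := comparison_estimate sp0 p1 oD0 bD0 q0 mq bq cu u01 wu t0
  (fun x => @qA2 t x t1) mzeta zeta1 gz Uout
  (ltW eps0) (ltW c0) (ltW k00) (mulr_ge0 C0 (powR_ge0 d th)) K0
  gap (@measurableT _ V) (mball z0 rho) _ _ _ KP.
have {}est : ((c * k0)%:E * (\int[mu]_x (w x * \1_(setT : set V) x)%:E * mu Z) <=
    (eps + 2 * (C * d `^ th) * K)%:E * \int[mu]_x (w x)%:E)%E.
  apply: est.
  - move=> x y wx _ yZ; have := Zc1 _ yZ; rewrite /= => yc1.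
    have xr := w_supp _ wx; have [[D0x _] _ _] := rB _ xr.
    have zy := zeta_le y.
    have wx' : 0 < u (t *: x) + zeta x - u x by move: wx; rewrite lt_max ltxx orbF.
    have yneg : u (t *: y) + zeta y - u y <= - (c1 / 2).
      have cc : c1 = c1 / 2 + c1 / 2 by rewrite -splitr.
      move: yc1 zy dc; move: (c1 / 2) cc => h -> {}yc1 zy dc; lra.
    have yneg0 : u (t *: y) + zeta y - u y < 0 by rewrite (le_lt_trans yneg)// oppr_lt0.
    split; first by rewrite -subr_le0 ltW.
      by rewrite -[c1 / 2]add0r -[c1 / 2]opprK lerB// ltW.
    have xy : x != y.
      by apply/eqP => xy; move: yneg0; rewrite -xy ltNge (ltW wx').
    apply: frac_kernel_ge => //.
    rewrite (le_trans (ler_normB _ _))// lerD//; first exact: MD0.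
    move: yZ; rewrite -ball_normE /ball_/= => yZ.
    rewrite -(subrK z0 y) (le_trans (ler_normD _ _))// addrC lerD2l distrC.
    exact: ltW.
  - move=> x Dx; have [wx|wx] := ltP 0 (w x); last first.
      have -> : Num.max (u (t *: x) + zeta x - u x) 0 = 0.
        by apply/eqP; rewrite eq_le wx w0.
      by rewrite !mulr0.
    have [_ _ Jx] := rB _ (w_supp _ wx).
    rewrite ler_wpM2r ?(ltW wx)//.
    apply: (@le_trans _ _ (Mq * (J (u x) - J (u (t *: x))))).
      by rewrite ler_wpM2r ?qM// subr_ge0 signed_pow_le.
    by rewrite mulrC -ler_pdivlMr// ltW.
  - move=> x y wx; have xr := w_supp _ wx.
    rewrite (_ : u (t *: x) + zeta x - _ =
      u (t *: x) - u (t *: y) + d * (tent y0 r x - tent y0 r y)).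
      exact: errC.
    by rewrite /zeta; ring.
have iw : mu.-integrable setT (EFin \o w).
  apply: (@bounded_support_integrable _ _ D _ 1) => //.
  - exact: annulus_bounded.
  - move=> x; rewrite ger0_norm ?w0// /w ge_max ler01 andbT.
    by have := ut_le x; have := zeta1 x; lra.
have [I IE] : exists I : R, (\int[mu]_x (w x)%:E = I%:E)%E.
  exists (fine (\int[mu]_x (w x)%:E)%E); rewrite fineK//.
  exact: integrable_fin_num iw.
have I0 : 0 < I.
  have wy0 : d / 2 < w y0.
    by rewrite /w lt_max uy0 addrAC subrr add0r /zeta tent_center// mulr1
      ltr_pdivrMr// ltr_pMr// ltr1n.
  have cw : {for y0, continuous (fun x : V => u (t *: x) + zeta x - u x)}.
    apply: (cvgB _ (@cu y0)); apply: (cvgD (@cut y0)).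
    by apply: cvgMr; exact: tent_continuous.
  have : \forall x \near (y0 : V), d / 2 < u (t *: x) + zeta x - u x.
    apply: (cvgr_gt _ cw).
    by rewrite /= uy0 addrAC subrr add0r /zeta tent_center// mulr1
      ltr_pdivrMr// ltr_pMr// ltr1n.
  move=> /nbhs_ballP[e /= e0 eB].
  rewrite -lte_fin -IE.
  apply: (@lt_le_trans _ _ (\int[mu]_x ((d / 2)%:E * (\1_(ball y0 e) x)%:E))%E).
    rewrite ge0_integralZl_EFin ?divr_ge0 ?(ltW d0)//; last first.
      by apply/measurable_EFinP; exact: measurable_indic.
    by rewrite integral_indic// setIT mule_gt0 ?lte_fin ?divr_gt0// lebesgue_ball_gt0.
  apply: ge0_le_integral => //.
  - by move=> y _; rewrite mule_ge0 ?lee_fin// divr_ge0// ltW.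
  - by apply: measurable_funeM; apply/measurable_EFinP; exact: measurable_indic.
  - exact/measurable_EFinP.
  move=> y _; rewrite -EFinM lee_fin indicE.
  have [yB|nyB] := pselect (ball y0 e y); last by rewrite memNset// mulr0 w0.
  by rewrite mem_set// mulr1 ltW// lt_max; apply/orP; left; exact: eB.
have {}est : c * k0 * (I * m) <= (eps + 2 * (C * d `^ th) * K) * I.
  move: est; rewrite IE muZE (_ : (\int[mu]_x _)%E = I%:E); last first.
    by rewrite -IE; apply: eq_integral => x _; rewrite indicT /= mulr1.
  by rewrite -!EFinM lee_fin.
have : eps + 2 * (C * d `^ th) * K <= 2 * eps.
  have -> : 2 * eps = eps + eps by rewrite mulr_natl mulr2n.
  rewrite lerD2l.
  apply: (@le_trans _ _ (2 * (C * K) * e')).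
    rewrite (_ : 2 * (C * _) * K = 2 * (C * K) * d `^ th); last by ring.
    by rewrite ler_wpM2l// !mulr_ge0.
  rewrite /e' [leLHS]mulrA ler_pdivrMr// [leLHS]mulrC ler_wpM2l ?(ltW eps0)//.
  by rewrite lerDl.
move=> /(ler_wpM2r (ltW I0))/(le_trans est).
rewrite (mulrC I) mulrA ler_pM2r//.
have -> : c * k0 * m = 4 * eps by rewrite /eps [RHS]mulrC divfK.
by rewrite ler_pM2r// ler_nat.
Qed.

Hypotheses (oD1 : open D1) (D10 : D1 0).

Lemma solution_origin : u 0 = 1.
Proof. by apply: solution1; exact: subset_closure. Qed.

(** Otherwise [u] vanishes at all points [t^-k x0] as soon as it vanishes at
    [x0]; for [x0] outside [D0] these points enter [D1], where [u = 1]. *)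
Lemma scaled_lt_somewhere (t : R) : 1 < t -> exists z0, u (t *: z0) < u z0.
Proof.
move=> t1; have t0 : 0 < t by rewrite (lt_trans _ t1).
apply: contrapT => noz.
have uge z : u z <= u (t *: z) by rewrite leNgt; apply/negP => ?; apply: noz; exists z.
have [M M0 MD0] := D0_bound.
pose x0 : V := const_mx (M + 1).
have ux0 : u x0 = 0.
  apply: solution0 => /MD0; apply/negP; rewrite -ltNge.
  rewrite (lt_le_trans _ (norm_coord x0 (Ordinal N1)))// mxE ger0_norm ?ltrDl//.
  by rewrite addr_ge0// ltW.
have uk k : u (t^-1 ^+ k *: x0) = 0.
  elim: k => [|k ih]; first by rewrite expr0 scale1r.
  apply/eqP; rewrite eq_le; have /andP[-> _] := u01 (t^-1 ^+ k.+1 *: x0).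
  rewrite andbT (le_trans (uge _))// scalerA exprS mulrA divff ?gt_eqF// mul1r.
  by rewrite ih.
have /nbhs_ballP[e /= e0 eD1] : nbhs (0 : V) D1 by exact: open_nbhs_nbhs.
have x00 : 0 < `|x0| + 1 by rewrite ltr_wpDl.
have tV1 : `|t^-1| < 1 by rewrite gtr0_norm ?invr_gt0// invf_lt1.
have ex0 : 0 < e / (`|x0| + 1) by rewrite divr_gt0.
have [k _ /(_ k (leqnn k))] := cvgr0_norm_lt _ (cvg_expr tV1) _ ex0.
rewrite /= ltr_pdivlMr// => kx.
have : D1 (t^-1 ^+ k *: x0).
  apply: eD1; rewrite -ball_normE /ball_/= sub0r normrN normrZ.
  by rewrite (le_lt_trans _ kx)// ler_wpM2l// lerDl.
move=> /(@subset_closure V D1)/solution1; rewrite uk => /esym/eqP.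
by rewrite oner_eq0.
Qed.

Lemma superlevel_starshaped (l : R) : l <= 1 -> starshaped (superlevel u l).
Proof.
move=> l1; split; first by rewrite /superlevel/= solution_origin.
move=> tau /andP[tau0 tau1] _ [x lx <-]; rewrite /superlevel/= in lx *.
have [->|tau_neq0] := eqVneq tau 0; first by rewrite scale0r solution_origin.
have {}tau0 : 0 < tau by rewrite lt_def tau_neq0.
have tV1 : 1 <= tau^-1 by rewrite invf_ge1.
rewrite (le_trans lx)//; have := scaled_le (tau *: x) tV1.
by rewrite scalerA mulVf// scale1r.
Qed.

Hypothesis pert : forall (t : R) (x : V), 1 < t -> D x -> D (t *: x) ->
  small_perturbation s p (fun y : V => u (t *: y)) x.

Lemma scaled_lt (t : R) (x : V) : 1 < t -> 0 < u x < 1 -> u (t *: x) < u x.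
Proof.
move=> t1 /andP[ux0 ux1]; have t1' := ltW t1.
have D0x : D0 x by apply: contrapT => /solution0 ux; rewrite ux ltxx in ux0.
have nD1x : ~ closure D1 x by move=> /solution1 ux; rewrite ux ltxx in ux1.
have [D0tx|nD0tx] := pselect (D0 (t *: x)); last by rewrite solution0.
have nD1tx : ~ closure D1 (t *: x).
  by move=> D1tx; apply: nD1x; exact: starshaped_scale_inv (starshaped_closure sD1) t1' D1tx.
rewrite lt_neqAle scaled_le// andbT; apply/eqP => utx.
have [z0 uz0] := scaled_lt_somewhere t1.
exact: (no_touching t1' _ _ utx uz0 (pert t1 _ _)).
Qed.

Lemma superlevel_boundary (l : R) x : boundary (superlevel u l) x -> u x = l.
Proof.
move=> [clx nix].
have clA : closed (superlevel u l).
  rewrite (_ : superlevel u l = u @^-1` [set y | l <= y])//.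
  by apply: preimage_closed; [move=> y _; exact: cu|exact: closed_ge].
have lx : l <= u x by move/closure_id : clA => clA; rewrite -clA in clx.
apply/eqP; rewrite eq_le lx andbT leNgt; apply/negP => ltx; apply: nix.
have : \forall y \near (x : V), l < u y by exact: (cvgr_gt _ (@cu x)).
by apply: filterS => y /ltW.
Qed.

(** On a ray [u] goes continuously from [1] to [0], so it takes the value [l].
    Since [u] decreases strictly through that value, the point where it is
    taken is unique and lies on the boundary. *)
Lemma superlevel_strictly_starshaped (l : R) : 0 < l < 1 ->
  strictly_starshaped (superlevel u l).
Proof.
move=> /andP[l0 l1]; split.
  have : nbhs (0 : V) D1 by exact: open_nbhs_nbhs.
  apply: filterS => y /(@subset_closure V D1)/solution1 uy.
  by rewrite /superlevel/= uy ltW.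
move=> v v0; have nv0 : 0 < `|v| by rewrite normr_gt0.
have [M M0 MD0] := D0_bound.
pose T := (M + 1) / `|v|.
have T0 : 0 < T by rewrite divr_gt0// addr_gt0.
have uT : u (T *: v) = 0.
  apply: solution0 => /MD0; apply/negP; rewrite -ltNge normrZ gtr0_norm//.
  by rewrite divfK ?gt_eqF// ltrDl.
have cf : continuous (fun tau : R => u (tau *: v)).
  move=> tau; apply: (@continuous_comp _ _ _ (fun tau : R => tau *: v) u).
    exact: scalel_continuous.
  exact: cu.
have [|tau] := @IVT R (fun tau => u (tau *: v)) 0 T l (ltW T0) (continuous_subspaceT cf).
  rewrite scale0r solution_origin uT ge_min le_max (ltW l0) (ltW l1) orbT.
  by [].
rewrite in_itv/= => /andP[tau0 _] utau.
have bdry : (ray v `&` boundary (superlevel u l)) (tau *: v).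
  split; first by exists tau.
  split; first by apply: subset_closure; rewrite /superlevel/= utau.
  move=> /nbhs_ballP[e /= e0 eA].
  pose y := tau *: v; pose t := 1 + e / (2 * (`|y| + 1)).
  have y10 : 0 < `|y| + 1 by rewrite ltr_wpDl.
  have te0 : 0 < e / (2 * (`|y| + 1)) by rewrite divr_gt0// mulr_gt0.
  have t1 : 1 < t by rewrite ltrDl.
  have : superlevel u l (t *: y).
    apply: eA; rewrite -ball_normE /ball_/= -/y -{1}[y]scale1r -scalerBl normrZ.
    rewrite opprD addrA subrr sub0r normrN gtr0_norm//.
    rewrite mulrAC ltr_pdivrMr ?mulr_gt0// ltr_pM2l//.
    by rewrite (lt_le_trans (_ : _ < `|y| + 1))// ?ltrDl// ler_peMl ?(ltW y10)// ler1n.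
  rewrite /superlevel/= leNgt; apply/negP; rewrite negbK -utau.
  by apply: scaled_lt => //; rewrite utau l0.
exists (tau *: v); split => // _ [[tau' /= tau'0 <-] /superlevel_boundary utau'].
have pos (a : R) : 0 <= a -> u (a *: v) = l -> 0 < a.
  move=> a0 ua; rewrite lt_def a0 andbT; apply/eqP => aE.
  by move: l1; rewrite -ua aE scale0r solution_origin ltxx.
have mono (a b : R) : 0 < a -> a < b -> u (a *: v) = l -> u (b *: v) = l -> False.
  move=> a0 ab ua ub; have ba : 1 < b / a by rewrite ltr_pdivlMr// mul1r.
  have : u ((b / a) *: (a *: v)) < u (a *: v).
    by apply: scaled_lt => //; rewrite ua l0.
  by rewrite scalerA divfK ?gt_eqF// ua ub ltxx.
have [lt1|lt2|->//] := ltgtP tau tau'.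
  by case: (mono tau tau' (pos _ tau0 utau) lt1 utau utau').
by case: (mono tau' tau (pos _ tau'0 utau') lt2 utau' utau).
Qed.

End scaled_comparison.

Theorem theorem1p2 (R : realType) (N : nat) (s p : R)
    (D0 D1 D : set 'rV[R]_N) (q u : 'rV[R]_N -> R) :
  (1 <= N)%N -> 0 < s < 1 -> 1 < p ->
  open D0 -> bounded_set D0 -> open D1 -> bounded_set D1 ->
  D1 0 -> closure D1 `<=` D0 ->
  D = D0 `\` closure D1 ->
  (forall x, D x -> 0 <= q x) ->
  measurable_fun D q -> [bounded q x | x in D] ->
  (forall (t : R) (x : 'rV[R]_N), 1 <= t -> D x -> D (t *: x) ->
     q x <= t `^ (s * p) * q (t *: x)) ->
  continuous u -> [bounded u x | x in [set: 'rV[R]_N]] ->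
  weak_solution s p D0 D1 q u ->
  (forall x, 0 <= u x <= 1) ->
  starshaped D0 -> starshaped D1 ->
  (forall l : R, 0 < l < 1 -> starshaped (superlevel u l)) /\
  (strictly_starshaped D0 -> strictly_starshaped D1 ->
   (((1 - s)^-1 < p /\ p <= 2) \/
    (2 <= p /\ exists alpha : R,
       [/\ 0 < alpha, alpha <= 1, holder_loc alpha D u &
           s * p - 1 < alpha * (p - 2)])) ->
   forall l : R, 0 < l < 1 -> strictly_starshaped (superlevel u l)).
Proof.
move=> N1 s01 p1 oD0 bD0 oD1 _ D10 _ -> q0 mq bq qA2 cu _ wu u01 sD0 sD1.
split=> [l /andP[_ l1]|_ _ cases l l01].
  exact: (superlevel_starshaped N1 s01 p1 oD0 bD0 q0 mq bq cu u01 wu qA2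
    sD0 sD1 D10 (ltW l1)).
apply: (superlevel_strictly_starshaped N1 s01 p1 oD0 bD0 q0 mq bq cu u01 wu qA2
  sD0 sD1 oD1 D10 _ l01) => t x t1 Dx Dtx.
case: cases => [[sp p2]|[p2 [alpha [a0 a1 hu sa]]]].
  by apply: small_perturbation_sub => //; case/andP: s01.
apply: (small_perturbation_super _ _ Dtx p2 u01 a0 a1 hu sa).
  exact: lt_trans t1.
by rewrite setDE; apply: openI => //; apply: closed_openC; exact: closed_closure.
Qed.
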